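(* Let $0<\eta<T$, $0<\alpha<\frac{2T}{\eta^2}$ and $0\le\beta<\frac{2T-\alpha\eta^2}{\alpha\eta^2-2\eta+2T}$ be real constants. Let $f\in C([0,\infty),[0,\infty))$, and let $a\in C([0,T],[0,\infty))$ be such that there exists $t_0\in[\eta,T]$ with $a(t_0)>0$. Let $\gamma$, $\Lambda_1$ and $\Lambda_2$ be the constants defined in the context. Assume that (i) the limit $\lim_{u\to0^+}\frac{f(u)}{u}=\alpha_2$ exists with $\alpha_2\in\left(\frac{\theta_2}{\gamma}\Lambda_2,\infty\right)$, where $\theta_2\ge1$; (ii) the limit $\lim_{u\to\infty}\frac{f(u)}{u}=\beta_2$ exists with $\beta_2\in[0,\theta_1\Lambda_1)$, where $\theta_1\in(0,1]$. Then the boundary value problem $$u''(t)+a(t)f(u(t))=0,\quad 0<t<T,\qquad u(0)=\beta u(\eta),\quad u(T)=\alpha\int_0^\eta u(s)\,ds,$$ has at least one positive solution.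
   Context: A positive solution of the boundary value problem is a function $u\in C([0,T])$, twice continuously differentiable on $(0,T)$, satisfying the differential equation on $(0,T)$ and both boundary conditions, with $u(t)\ge0$ on $[0,T]$ and $u(t)>0$ for $t\in(0,T)$. Define $$\gamma=\min\left\{\frac{\eta}{T},\ \frac{\alpha(\beta+1)\eta^2}{2T},\ \frac{\alpha(\beta+1)\eta(T-\eta)}{2T-\alpha(\beta+1)\eta^2}\right\}\in(0,1),$$ $$\Lambda_1=\frac{(2T-\alpha\eta^2)-\beta(\alpha\eta^2-2\eta+2T)}{\left[2(\beta+1)+T^{-1}\beta\eta(\alpha\eta+2)+\alpha\beta T\right]\int_0^T T(T-s)a(s)\,ds},$$ $$\Lambda_2=\frac{(2T-\alpha\eta^2)-\beta(\alpha\eta^2-2\eta+2T)}{2\gamma\eta\int_\eta^T(T-s)a(s)\,ds}.$$ *)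

(* Defs.v *)
From Stdlib Require Import Reals.
From Coquelicot Require Import Coquelicot.

Open Scope R_scope.

(** Functions on [[0,T]] or [[0,oo)] are represented by total functions
    [R -> R] of which only the values on that set matter: [continuous_on] is
    continuity relative to the set, and [RInt v x y] does not depend on [v]
    outside the interval of integration. *)

Definition cc (x y : R) : R -> Prop := fun t => x <= t <= y.

Definition half_line : R -> Prop := fun x => 0 <= x.

(** [ex_derive_n u 2 t] alone only says that [Derive u] is differentiable at
    [t]; as [Derive] is total, differentiability of [u] must be required too. *)
Definition C2_open (u : R -> R) (x y : R) : Prop :=
  forall t, x < t < y ->
    ex_derive u t /\ ex_derive (Derive u) t /\ continuous (Derive_n u 2) t.

Definition bvp_solution (T eta alpha beta : R) (a f u : R -> R) : Prop :=
  (forall t, 0 < t < T -> Derive_n u 2 t + a t * f (u t) = 0) /\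
  u 0 = beta * u eta /\
  u T = alpha * RInt u 0 eta.

Definition positive_solution (T eta alpha beta : R) (a f u : R -> R) : Prop :=
  continuous_on (cc 0 T) u /\
  C2_open u 0 T /\
  bvp_solution T eta alpha beta a f u /\
  (forall t, 0 <= t <= T -> 0 <= u t) /\
  (forall t, 0 < t < T -> 0 < u t).

Definition gamma (T eta alpha beta : R) : R :=
  Rmin (eta / T)
    (Rmin (alpha * (beta + 1) * eta ^ 2 / (2 * T))
          (alpha * (beta + 1) * eta * (T - eta)
             / (2 * T - alpha * (beta + 1) * eta ^ 2))).

Definition Lambda1 (T eta alpha beta : R) (a : R -> R) : R :=
  ((2 * T - alpha * eta ^ 2) - beta * (alpha * eta ^ 2 - 2 * eta + 2 * T))
  / ((2 * (beta + 1) + / T * beta * eta * (alpha * eta + 2) + alpha * beta * T)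
     * RInt (fun s => T * (T - s) * a s) 0 T).

Definition Lambda2 (T eta alpha beta : R) (a : R -> R) : R :=
  ((2 * T - alpha * eta ^ 2) - beta * (alpha * eta ^ 2 - 2 * eta + 2 * T))
  / (2 * gamma T eta alpha beta * eta * RInt (fun s => (T - s) * a s) eta T).

(* Main.v *)
(** With [y = a f(u)], the boundary value problem reads
    [u t = A + q t - int_0^t (t - s) y s ds], where [A] and [q] solve a 2x2 linear
    system in [int_0^T (T-s) y], [int_0^eta (eta-s) y] and [int_0^eta (eta-s)^2 y].
    First replace [f u] by [f (max (eps t) (min u R))], which is bounded.
    Delaying the argument of the nonlinearity turns the initial value problem into
    an explicit recursion, continuous in [(A, q)], so a Brouwer argument in the
    plane (Sperner's lemma on a grid) matches both boundary conditions
    approximately; Arzela-Ascoli lets the delay tend to 0.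
    Sublinearity at infinity and the definition of [Lambda1] give [u <= R].
    If [u] stayed below a small [r0], the definition of [Lambda2] would give
    [gamma u(eta) > gamma u(eta)]; hence [u] reaches [r0], and concavity with the
    boundary condition at [T] gives [u t >= eps t] for a suitable [eps].  So the
    truncation was inactive and [u] is positive. *)

Require Import Defs.
From Stdlib Require Import Reals Lra Lia Classical ClassicalChoice.
From Coquelicot Require Import Coquelicot.
From mathcomp.classical Require filter.
Open Scope R_scope.

(** * Approximate fixed points in the plane *)

(** As [f] is merely continuous, an initial value problem for [u'' = - a f(u)] may have several
    solutions, so there is no shooting map in [(A, q)]. With a delay the solution is computed by
    finitely many integrations, and the boundary conditions turn it into a new pair [(A, q)]: the
    unknown is a point of the plane, and boundedness of the truncated nonlinearity confines it to a
    square. The lower cutoff [eps t] excludes the zero function, which solves the boundary value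
    problem whenever [f 0 = 0]. There is no circularity: the lower bound obtained for [u] involves
    [r0] but not [eps], so a suitable [eps] can be read off from it in advance. The hypotheses on
    the two limits enter as [Lambda2 < alpha2] and [beta2 < Lambda1], because [theta2 / gamma >= 1]
    and [theta1 <= 1]. *)

Inductive label := L0 | L1 | L2.

Definition door (x y : label) : bool :=
  match x, y with
  | L0, L1 | L1, L0 => true
  | _, _ => false
  end.

(* In a triangle that misses a label, [door] satisfies the cocycle identity
   [door x y + door y z = door x z] modulo 2; this is the sum over two
   triangles sharing a diagonal. *)
Lemma door_cell (a b c d : label) :
  xorb (door a b) (door b d) <> xorb (door a c) (door c d) ->
  forall k, k = a \/ k = b \/ k = c \/ k = d.
Proof.
  intros H k; destruct a, b, c, d; simpl in H; try congruence; destruct k; tauto.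
Qed.

Definition full_cell (lab : nat -> nat -> label) (i j : nat) : Prop :=
  forall k, exists i' j', (i' = i \/ i' = S i) /\ (j' = j \/ j' = S j) /\
    lab i' j' = k.

Fixpoint row_doors (lab : nat -> nat -> label) (j k : nat) : bool :=
  match k with
  | O => false
  | S k' => xorb (row_doors lab j k') (door (lab k' j) (lab (S k') j))
  end.

(** Both sides count, modulo 2, the doors on a path between opposite corners of a strip: along the
    bottom and up, or up and along the top. The first path is deformed into the second cell by cell,
    and a cell that is not full preserves the parity. *)
Lemma row_doors_step (lab : nat -> nat -> label) (j n : nat) :
  (forall i, (i < n)%nat -> ~ full_cell lab i j) ->
  xorb (row_doors lab j n) (door (lab n j) (lab n (S j)))
  = xorb (door (lab 0%nat j) (lab 0%nat (S j))) (row_doors lab (S j) n).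
Proof.
  induction n as [|n IH]; intros H; simpl.
  - now rewrite Bool.xorb_false_r; destruct (door _ _).
  - assert (IH' := IH (fun i Hi => H i (Nat.lt_lt_succ_r _ _ Hi))).
    assert (E : xorb (door (lab n j) (lab (S n) j))
                     (door (lab (S n) j) (lab (S n) (S j)))
              = xorb (door (lab n j) (lab n (S j)))
                     (door (lab n (S j)) (lab (S n) (S j)))).
    { apply NNPP; intros Hne; apply (H n); [lia|].
      intros k; destruct (door_cell _ _ _ _ Hne k) as [->|[->|[->| ->]]].
      - exists n, j; tauto.
      - exists (S n), j; tauto.
      - exists n, (S j); tauto.
      - exists (S n), (S j); tauto. }
    revert E IH'.
    destruct (row_doors lab j n), (row_doors lab (S j) n), (door (lab n j) (lab (S n) j)),
      (door (lab n j) (lab n (S j))), (door (lab (S n) j) (lab (S n) (S j))),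
      (door (lab n (S j)) (lab (S n) (S j))), (door (lab 0%nat j) (lab 0%nat (S j)));
      simpl; congruence.
Qed.

(** The bottom side runs from [L0] to [L1] without [L2], so it has an odd number of doors; the top
    side has none. The vertical sides have no doors either, so without a full cell the parity would
    pass unchanged from bottom to top. *)
Lemma sperner_square (n : nat) (lab : nat -> nat -> label) :
  (forall j, (j <= n)%nat -> lab 0%nat j <> L1) ->
  (forall j, (j <= n)%nat -> lab n j = L1) ->
  (forall i, (i <= n)%nat -> lab i 0%nat <> L2) ->
  (forall i, (i <= n)%nat -> lab i n <> L0) ->
  exists i j, (i < n)%nat /\ (j < n)%nat /\ full_cell lab i j.
Proof.
  intros Hl Hr Hb Ht; apply NNPP; intros Hno.
  assert (Hbot : forall k, (k <= n)%nat ->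
            row_doors lab 0 k = door (lab 0%nat 0%nat) (lab k 0%nat)).
  { induction k as [|k IH]; intros Hk; simpl.
    - now destruct (lab 0%nat 0%nat).
    - rewrite IH by lia.
      generalize (Hb 0%nat ltac:(lia)) (Hb k ltac:(lia)) (Hb (S k) Hk).
      destruct (lab 0%nat 0%nat), (lab k 0%nat), (lab (S k) 0%nat);
        simpl; congruence. }
  assert (Htop : forall k, (k <= n)%nat -> row_doors lab n k = false).
  { induction k as [|k IH]; intros Hk; simpl; [easy|].
    rewrite IH by lia; generalize (Ht k ltac:(lia)) (Ht (S k) Hk).
    destruct (lab k n), (lab (S k) n); simpl; congruence. }
  assert (Hall : forall j, (j <= n)%nat -> row_doors lab j n = true).
  { induction j as [|j IH]; intros Hj.
    - rewrite Hbot, Hr by lia.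
      generalize (Hl 0%nat ltac:(lia)) (Hb 0%nat ltac:(lia)).
      destruct (lab 0%nat 0%nat); simpl; congruence.
    - assert (E : xorb (row_doors lab j n) (door (lab n j) (lab n (S j)))
        = xorb (door (lab 0%nat j) (lab 0%nat (S j))) (row_doors lab (S j) n)).
      { apply row_doors_step; intros i Hi Hf; apply Hno; exists i, j; auto. }
      rewrite IH, !Hr in E by lia.
      generalize (Hl j ltac:(lia)) (Hl (S j) Hj); revert E.
      destruct (lab 0%nat j), (lab 0%nat (S j)), (row_doors lab (S j) n);
        simpl; congruence. }
  generalize (Hall n (le_n n)); rewrite Htop by lia; discriminate.
Qed.

Definition unif_cont2 (P : R -> R -> R) : Prop :=
  forall e, 0 < e -> exists d, 0 < d /\ forall x y x' y',
    Rabs (x - x') < d -> Rabs (y - y') < d -> Rabs (P x y - P x' y') < e.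

(** The labels record which coordinate the map decreases: [L1] for [P x y < x], otherwise [L2] for
    [Q x y < y], otherwise [L0]. At the [L0] corner of a full cell both [P x y - x] and [Q x y - y]
    are nonnegative, and uniform continuity together with the [L1] and [L2] corners makes them
    small. *)
Lemma approx_fixed_point_plane (P Q : R -> R -> R) (C e : R) :
  unif_cont2 P -> unif_cont2 Q ->
  (forall x y, - C < P x y < C) -> (forall x y, - C < Q x y < C) ->
  0 < e -> exists x y, Rabs (P x y - x) < e /\ Rabs (Q x y - y) < e.
Proof.
  intros HP HQ BP BQ He.
  assert (HC : 0 < C) by (generalize (BP 0 0); lra).
  destruct (HP (e / 2)) as (d1 & Hd1 & UP); [lra|].
  destruct (HQ (e / 2)) as (d2 & Hd2 & UQ); [lra|].
  set (d := Rmin (e / 2) (Rmin d1 d2)).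
  assert (Hd : 0 < d) by (unfold d; repeat apply Rmin_pos; lra).
  assert (Hde : d <= e / 2) by apply Rmin_l.
  assert (Hdd1 : d <= d1) by (eapply Rle_trans; [apply Rmin_r|apply Rmin_l]).
  assert (Hdd2 : d <= d2) by (eapply Rle_trans; [apply Rmin_r|apply Rmin_r]).
  destruct (archimed_cor1 (d / (2 * C))) as (n & Hn & Hn0).
  { apply Rdiv_lt_0_compat; lra. }
  assert (Hnn : 0 < INR n) by (apply lt_0_INR; lia).
  set (h := 2 * C / INR n).
  assert (Hh : 0 < h) by (apply Rdiv_lt_0_compat; lra).
  assert (Hhd : h < d).
  { unfold h, Rdiv; apply Rmult_lt_reg_l with (/ (2 * C)).
    - apply Rinv_0_lt_compat; lra.
    - replace (/ (2 * C) * (2 * C * / INR n)) with (/ INR n) by (field; lra).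
      now rewrite Rmult_comm. }
  set (g := fun i : nat => - C + INR i * h).
  assert (g0 : g 0%nat = - C) by (unfold g; simpl; ring).
  assert (gn : g n = C) by (unfold g, h; field; lra).
  assert (gS : forall i i1 i2, (i1 = i \/ i1 = S i) -> (i2 = i \/ i2 = S i) ->
            Rabs (g i1 - g i2) < d).
  { intros i i1 i2 H1 H2; unfold g.
    destruct H1 as [-> | ->], H2 as [-> | ->]; rewrite ?S_INR; apply Rabs_def1; lra. }
  set (lab := fun i j : nat =>
    if Rlt_dec (P (g i) (g j)) (g i) then L1
    else if Rlt_dec (Q (g i) (g j)) (g j) then L2 else L0).
  destruct (sperner_square n lab) as (i & j & _ & _ & Hf).
  - intros j _; unfold lab; rewrite g0; generalize (BP (- C) (g j)); intros.
    destruct (Rlt_dec _ _); [lra|]; destruct (Rlt_dec _ _); discriminate.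
  - intros j _; unfold lab; rewrite gn; generalize (BP C (g j)); intros.
    destruct (Rlt_dec _ _); [easy|lra].
  - intros i _; unfold lab; rewrite g0; generalize (BQ (g i) (- C)); intros.
    destruct (Rlt_dec _ _); [discriminate|]; destruct (Rlt_dec _ _); [lra|discriminate].
  - intros i _; unfold lab; rewrite gn; generalize (BQ (g i) C); intros.
    destruct (Rlt_dec _ _); [discriminate|]; destruct (Rlt_dec _ _); [discriminate|lra].
  - destruct (Hf L0) as (i0 & j0 & Hi0 & Hj0 & E0).
    destruct (Hf L1) as (i1 & j1 & Hi1 & Hj1 & E1).
    destruct (Hf L2) as (i2 & j2 & Hi2 & Hj2 & E2).
    exists (g i0), (g j0).
    assert (I1 := gS i i0 i1 Hi0 Hi1). assert (I2 := gS i i0 i2 Hi0 Hi2).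
    assert (J1 := gS j j0 j1 Hj0 Hj1). assert (J2 := gS j j0 j2 Hj0 Hj2).
    assert (U1 := UP (g i0) (g j0) (g i1) (g j1) ltac:(lra) ltac:(lra)).
    assert (U2 := UQ (g i0) (g j0) (g i2) (g j2) ltac:(lra) ltac:(lra)).
    apply Rabs_def2 in I1, J2, U1, U2.
    unfold lab in E0, E1, E2.
    destruct (Rlt_dec (P (g i0) (g j0)) (g i0)); [discriminate|].
    destruct (Rlt_dec (Q (g i0) (g j0)) (g j0)); [discriminate|].
    destruct (Rlt_dec (P (g i1) (g j1)) (g i1));
      [|destruct (Rlt_dec (Q (g i1) (g j1)) (g j1)); discriminate].
    destruct (Rlt_dec (P (g i2) (g j2)) (g i2)); [discriminate|].
    destruct (Rlt_dec (Q (g i2) (g j2)) (g j2)); [|discriminate].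
    split; apply Rabs_def1; lra.
Qed.

(** * Compactness of equi-Lipschitz sequences *)

Definition free_ultrafilter (U : (nat -> Prop) -> Prop) : Prop :=
  (forall N, U (fun n => (N <= n)%nat)) /\
  (forall P Q : nat -> Prop, (forall n, P n -> Q n) -> U P -> U Q) /\
  (forall P Q, U P -> U Q -> U (fun n => P n /\ Q n)) /\
  (forall P, U P -> exists n, P n) /\
  (forall P, U P \/ U (fun n => ~ P n)).

(** An ultrafilter finer than the Frechet filter of eventual properties. *)
Lemma free_ultrafilter_exists : exists U, free_ultrafilter U.
Proof.
  set (F := fun P : nat -> Prop => exists N, forall n, (N <= n)%nat -> P n).
  assert (HF : filter.ProperFilter F).
  { constructor.
    - intros [N HN]; exact (HN N (le_n N)).
    - constructor.
      + now exists 0%nat.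
      + intros P Q [N HN] [M HM]; exists (Nat.max N M); intros n Hn.
        split; [apply HN|apply HM]; lia.
      + intros P Q HPQ [N HN]; exists N; intros n Hn; apply HPQ, HN, Hn. }
  destruct (filter.ultraFilterLemma HF) as (U & HU & HFU).
  assert (PU := @filter.ultra_proper _ _ HU).
  exists U; split; [|split; [|split; [|split]]].
  - intros N; apply HFU; now exists N.
  - intros P Q H; now apply (filter.filterS).
  - intros P Q HP HQ; now apply (filter.filterI).
  - intros P HP; apply NNPP; intros Hn.
    apply (filter.filter_not_empty U).
    revert HP; apply filter.filterS; intros n Pn; apply Hn; now exists n.
  - intros P; exact (filter.in_ultra_setVsetC P HU).
Qed.

(** The limit is the supremum of the [r] with [r <= x n] for [U]-almost all [n]. The dichotomy of
    the ultrafilter yields the upper estimate. *)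
Lemma ultralimit (U : (nat -> Prop) -> Prop) (x : nat -> R) (lo hi : R) :
  free_ultrafilter U -> (forall n, lo <= x n <= hi) ->
  exists l, lo <= l <= hi /\ forall e, 0 < e -> U (fun n => Rabs (x n - l) < e).
Proof.
  intros (Ufree & Umono & Uand & Uex & Uor) Hx.
  set (E := fun r => U (fun n => r <= x n)).
  destruct (completeness E) as [l [lub1 lub2]].
  - exists hi; intros r Hr; destruct (Uex _ Hr) as [n Hn].
    generalize (Hx n); lra.
  - exists lo; apply Umono with (2 := Ufree 0%nat); intros n _; apply Hx.
  - exists l; split; [split|].
    + apply lub1, Umono with (2 := Ufree 0%nat); intros n _; apply Hx.
    + apply lub2; intros r Hr; destruct (Uex _ Hr) as [n Hn].
      generalize (Hx n); lra.
    + intros e He.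
      assert (H1 : U (fun n => l - e < x n)).
      { apply NNPP; intros Hn.
        assert (l <= l - e); [|lra].
        apply lub2; intros r Hr; destruct (Rle_dec r (l - e)) as [|Hre]; [easy|].
        exfalso; apply Hn; revert Hr; apply Umono; intros; lra. }
      assert (H2 : U (fun n => ~ (l + e / 2 <= x n))).
      { destruct (Uor (fun n => l + e / 2 <= x n)) as [Hc|Hc]; [|easy].
        assert (l + e / 2 <= l); [apply lub1; exact Hc|lra]. }
      generalize (Uand _ _ H1 H2); apply Umono; intros n [A B].
      apply Rabs_def1; lra.
Qed.

(* Arzela-Ascoli, in the form of a cluster point: pointwise limits along a
   free ultrafilter replace the extraction of a subsequence. *)
Lemma equilipschitz_cluster (T L C : R) (u : nat -> R -> R) :
  0 <= T -> 0 <= L ->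
  (forall n t, 0 <= t <= T -> Rabs (u n t) <= C) ->
  (forall n s t, 0 <= s <= T -> 0 <= t <= T ->
     Rabs (u n s - u n t) <= L * Rabs (s - t)) ->
  exists v : R -> R,
    (forall s t, 0 <= s <= T -> 0 <= t <= T ->
       Rabs (v s - v t) <= L * Rabs (s - t)) /\
    (forall e N, 0 < e -> exists n, (N <= n)%nat /\
       forall t, 0 <= t <= T -> Rabs (u n t - v t) < e).
Proof.
  intros HT HL Hb Hlip.
  destruct free_ultrafilter_exists as [U HU].
  destruct (HU) as (Ufree & Umono & Uand & Uex & Uor).
  assert (Hlim : forall t, exists l, 0 <= t <= T ->
            forall e, 0 < e -> U (fun n => Rabs (u n t - l) < e)).
  { intros t; destruct (classic (0 <= t <= T)) as [Ht|Ht];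
      [|exists 0; tauto].
    destruct (ultralimit U (fun n => u n t) (- C) C HU) as (l & _ & Hl).
    - intros n; apply Rabs_le_between; auto.
    - exists l; intros _; exact Hl. }
  destruct (choice _ Hlim) as [v Hv].
  assert (Hvlip : forall s t, 0 <= s <= T -> 0 <= t <= T ->
            Rabs (v s - v t) <= L * Rabs (s - t)).
  { intros s t Hs Ht; apply le_epsilon; intros e He.
    destruct (Uex _ (Uand _ _ (Hv s Hs (e / 2) ltac:(lra))
                              (Hv t Ht (e / 2) ltac:(lra)))) as [n [A B]].
    generalize (Hlip n s t Hs Ht); intros D.
    apply Rabs_def2 in A, B; apply Rabs_le_between in D.
    apply Rabs_le_between; lra. }
  exists v; split; [exact Hvlip|]; intros e N He.
  destruct (Uor (fun n => forall t, 0 <= t <= T -> Rabs (u n t - v t) < e)) as [G|G].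
  - destruct (Uex _ (Uand _ _ (Ufree N) G)) as [n Hn]; now exists n.
  (* Otherwise, for [U]-almost all [n] there is a time [t n] at which [u n] is at least [e] away
     from [v]. At the ultralimit [s] of these times [u n s] is close to [v s], and the two Lipschitz
     bounds carry this back to [t n] with total error at most [3 e / 4]. *)
  - exfalso.
    assert (Hbad : forall n, exists t, 0 <= t <= T /\
       (~ (forall t, 0 <= t <= T -> Rabs (u n t - v t) < e) ->
        e <= Rabs (u n t - v t))).
    { intros n.
      destruct (classic (forall t, 0 <= t <= T -> Rabs (u n t - v t) < e)) as [H|H].
      - exists 0; split; [lra|tauto].
      - apply not_all_ex_not in H; destruct H as [t H]; apply imply_to_and in H.
        exists t; split; [tauto|lra]. }
    destruct (choice _ Hbad) as [t Ht].
    destruct (ultralimit U t 0 T HU) as (s & Hs & Hts).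
    { intros n; apply Ht. }
    set (d := e / (4 * (L + 1))).
    assert (Hd : 0 < d) by (apply Rdiv_lt_0_compat; lra).
    assert (HLd : L * d <= e / 4).
    { unfold d; apply Rmult_le_reg_r with (4 * (L + 1)); [lra|].
      field_simplify; nra. }
    destruct (Uex _ (Uand _ _ G (Uand _ _ (Hts d Hd) (Hv s Hs (e / 4) ltac:(lra)))))
      as [n (Gn & A & B)].
    destruct (Ht n) as [Htn Hn]; specialize (Hn Gn).
    generalize (Hlip n (t n) s Htn Hs) (Hvlip (t n) s Htn Hs); intros D1 D2.
    assert (L * Rabs (t n - s) <= L * d) by (apply Rmult_le_compat_l; lra).
    apply Rle_not_lt in Hn; apply Hn.
    apply Rabs_le_between in D1, D2; apply Rabs_def2 in B.
    apply Rabs_def1; lra.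
Qed.
(** * Retarded equations and their limit *)

Definition cont (y : R -> R) : Prop := forall t, continuous y t.

Definition prim (y : R -> R) (t : R) : R := RInt y 0 t.

Lemma cont_ex_RInt (y : R -> R) (a b : R) : cont y -> ex_RInt y a b.
Proof. intros Hy; apply (ex_RInt_continuous (V := R_CompleteNormedModule)); auto. Qed.

Lemma is_derive_prim (y : R -> R) (t : R) : cont y -> is_derive (prim y) t (y t).
Proof.
  intros Hy; apply (is_derive_RInt y (prim y) 0); [|apply Hy].
  apply filter_forall; intros b; apply (RInt_correct y), cont_ex_RInt, Hy.
Qed.

Lemma cont_prim (y : R -> R) : cont y -> cont (prim y).
Proof.
  intros Hy t; apply (ex_derive_continuous (prim y)); exists (y t).
  now apply is_derive_prim.
Qed.

Lemma prim_0 (y : R -> R) : prim y 0 = 0.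
Proof. apply (RInt_point 0 y). Qed.

Lemma prim_close (y z : R -> R) (M T t : R) :
  cont y -> cont z -> 0 <= t <= T ->
  (forall s, 0 <= s <= T -> Rabs (y s - z s) <= M) ->
  Rabs (prim y t - prim z t) <= T * M.
Proof.
  intros Hy Hz Ht HM.
  assert (0 <= M) by (generalize (HM 0 ltac:(lra)) (Rabs_pos (y 0 - z 0)); lra).
  unfold prim.
  replace (RInt y 0 t - RInt z 0 t) with (RInt (fun s => minus (y s) (z s)) 0 t)
    by (rewrite (RInt_minus y z); auto using cont_ex_RInt).
  apply Rle_trans with ((t - 0) * M).
  - apply abs_RInt_le_const; [lra| |].
    + apply (ex_RInt_minus y z); auto using cont_ex_RInt.
    + intros s Hs; apply HM; lra.
  - apply Rmult_le_compat_r; lra.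
Qed.

Lemma prim2_close (y z : R -> R) (M T t : R) :
  cont y -> cont z -> 0 <= t <= T ->
  (forall s, 0 <= s <= T -> Rabs (y s - z s) <= M) ->
  Rabs (prim (prim y) t - prim (prim z) t) <= T * (T * M).
Proof.
  intros Hy Hz Ht HM; apply prim_close; auto using cont_prim.
  intros s Hs; now apply prim_close.
Qed.

Lemma prim_lipschitz (y : R -> R) (M s t : R) :
  cont y -> (forall x, Rmin s t <= x <= Rmax s t -> Rabs (y x) <= M) ->
  Rabs (prim y s - prim y t) <= M * Rabs (s - t).
Proof.
  intros Hy HM.
  destruct (MVT_gen (prim y) t s y) as (c & Hc & ->).
  - intros; now apply is_derive_prim.
  - intros; apply continuity_pt_filterlim; now apply cont_prim.
  - rewrite Rabs_mult; apply Rmult_le_compat_r; [apply Rabs_pos|apply HM].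
    now rewrite Rmin_comm, Rmax_comm.
Qed.

Lemma prim_bound (y : R -> R) (M T t : R) :
  cont y -> 0 <= t <= T -> (forall s, 0 <= s <= T -> Rabs (y s) <= M) ->
  Rabs (prim y t) <= T * M.
Proof.
  intros Hy Ht HM; unfold prim.
  assert (0 <= M) by (generalize (HM 0 ltac:(lra)) (Rabs_pos (y 0)); lra).
  apply Rle_trans with ((t - 0) * M); [|apply Rmult_le_compat_r; lra].
  apply abs_RInt_le_const; [lra|now apply cont_ex_RInt|].
  intros s Hs; apply HM; lra.
Qed.

Definition clamp (lo hi t : R) : R := Rmax lo (Rmin t hi).

Lemma clamp_bounds (lo hi t : R) : lo <= hi -> lo <= clamp lo hi t <= hi.
Proof.
  intros H; unfold clamp, Rmax, Rmin.
  destruct (Rle_dec t hi), (Rle_dec lo _); lra.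
Qed.

Lemma clamp_id (lo hi t : R) : lo <= t <= hi -> clamp lo hi t = t.
Proof.
  intros H; unfold clamp, Rmax, Rmin.
  destruct (Rle_dec t hi), (Rle_dec lo _); lra.
Qed.

Lemma clamp_lipschitz (lo hi s t : R) :
  Rabs (clamp lo hi s - clamp lo hi t) <= Rabs (s - t).
Proof.
  unfold clamp, Rmax, Rmin, Rabs.
  destruct (Rle_dec s hi), (Rle_dec t hi);
  repeat match goal with
         | |- context [Rle_dec ?x ?y] => destruct (Rle_dec x y)
         | |- context [Rcase_abs ?x] => destruct (Rcase_abs x)
         end; lra.
Qed.

Lemma lipschitz_cont (x : R -> R) (L : R) :
  (forall s t, Rabs (x s - x t) <= L * Rabs (s - t)) -> cont x.
Proof.
  intros H t; apply filterlim_locally; intros e.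
  assert (HL : 0 < Rabs L + 1) by (generalize (Rabs_pos L); lra).
  assert (Hd : 0 < e / (Rabs L + 1)) by (apply Rdiv_lt_0_compat; [apply e|lra]).
  exists (mkposreal _ Hd); intros s Hs.
  change (Rabs (s - t) < e / (Rabs L + 1)) in Hs.
  change (Rabs (x s - x t) < e).
  eapply Rle_lt_trans; [apply H|].
  apply Rle_lt_trans with ((Rabs L + 1) * Rabs (s - t)).
  - apply Rmult_le_compat_r; [apply Rabs_pos|generalize (Rle_abs L); lra].
  - apply Rmult_lt_compat_l with (r := Rabs L + 1) in Hs; [|lra].
    replace (pos e) with ((Rabs L + 1) * (e / (Rabs L + 1))) by (field; lra); exact Hs.
Qed.

Lemma cont_clamp (lo hi : R) : cont (clamp lo hi).
Proof.
  apply (lipschitz_cont _ 1); intros s t; rewrite Rmult_1_l; apply clamp_lipschitz.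
Qed.

(* Solves [x'' = - y] on [[0,T]]; frozen outside, so that bounds on [[0,T]] hold
   on the whole line. *)
Definition path (T A q : R) (y : R -> R) (t : R) : R :=
  A + q * clamp 0 T t - prim (prim y) (clamp 0 T t).

Lemma cont_path (T A q : R) (y : R -> R) : cont y -> cont (path T A q y).
Proof.
  intros Hy t; unfold path.
  apply (continuous_minus (fun t => A + q * clamp 0 T t)).
  - apply (continuous_plus (fun _ => A)); [apply continuous_const|].
    apply (continuous_mult (fun _ => q)); [apply continuous_const|apply cont_clamp].
  - apply (continuous_comp (clamp 0 T)); [apply cont_clamp|].
    now apply cont_prim, cont_prim.
Qed.

Definition superposition (G : R -> R -> R) : Prop :=
  forall x, cont x -> cont (fun s => G s (x s)).

Definition unif_cont_snd (G : R -> R -> R) : Prop :=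
  forall e, 0 < e -> exists d, 0 < d /\
    forall t x x', Rabs (x - x') < d -> Rabs (G t x - G t x') < e.

(* Tonelli's retarded scheme for [x'' (t) = - G t (x (t - delta))]: the k-th
   iterate is the exact solution up to time [k * delta]. *)
Fixpoint tonelli (T : R) (G : R -> R -> R) (delta A q : R) (k : nat) : R -> R :=
  match k with
  | O => fun _ => A
  | S k' => path T A q (fun s => G s (tonelli T G delta A q k' (s - delta)))
  end.

Lemma cont_shift (x : R -> R) (d : R) : cont x -> cont (fun s => x (s - d)).
Proof.
  intros Hx t; apply (continuous_comp (fun s => s - d) x); [|apply Hx].
  apply (continuous_minus (fun s : R => s)); [apply continuous_id|apply continuous_const].
Qed.

Lemma cont_tonelli T G delta A q k :
  superposition G -> cont (tonelli T G delta A q k).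
Proof.
  intros HG; induction k as [|k IH]; simpl.
  - intros t; apply continuous_const.
  - apply cont_path, (HG (fun s => tonelli T G delta A q k (s - delta))).
    now apply cont_shift.
Qed.

Lemma prim_ext (y z : R -> R) (t : R) :
  0 <= t -> (forall s, 0 < s < t -> y s = z s) -> prim y t = prim z t.
Proof.
  intros Ht H; apply (RInt_ext y z); intros s Hs; apply H.
  now rewrite Rmin_left, Rmax_right in Hs.
Qed.

(** Up to time [t] an iterate reads the previous one only up to [t - delta], so each step gains an
    interval of length [delta]. For [k = 0] one has [t <= 0], where [path] is frozen at [A]. *)
Lemma tonelli_stable T G delta A q k t :
  0 <= T -> 0 < delta -> t <= INR k * delta ->
  tonelli T G delta A q (S k) t = tonelli T G delta A q k t.
Proof.
  intros HT Hd; revert t; induction k as [|k IH]; intros t Ht.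
  - simpl in Ht; simpl; unfold path.
    assert (E : clamp 0 T t = 0).
    { unfold clamp; apply Rmax_left; eapply Rle_trans; [apply Rmin_l|lra]. }
    rewrite E, prim_0; ring.
  - remember (S k) as k' eqn:Ek; simpl; subst k'.
    change (tonelli T G delta A q (S k) t)
      with (path T A q (fun s => G s (tonelli T G delta A q k (s - delta))) t).
    unfold path; f_equal.
    assert (Hc : clamp 0 T t <= Rmax 0 t).
    { apply Rle_max_compat_l, Rmin_l. }
    assert (Hc0 := clamp_bounds 0 T t HT).
    apply prim_ext; [lra|]; intros s Hs; apply prim_ext; [lra|]; intros r Hr.
    rewrite IH; [easy|].
    rewrite S_INR in Ht.
    assert (r < t) by (revert Hc; unfold Rmax; destruct (Rle_dec 0 t); lra).
    lra.
Qed.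

Lemma tonelli_exact T G delta A q k t :
  0 < T -> 0 < delta -> T <= INR k * delta ->
  tonelli T G delta A q k t
  = path T A q (fun s => G s (tonelli T G delta A q k (s - delta))) t.
Proof.
  intros HT Hd Hk.
  (* Iterates are frozen outside [[0,T]], so agreement on [[0,T]] gives the identity for every
     [t]. *)
  assert (Hfix : forall k t, tonelli T G delta A q (S k) (clamp 0 T t)
                           = tonelli T G delta A q (S k) t).
  { intros k' t'; simpl; unfold path.
    now rewrite (clamp_id 0 T (clamp 0 T t')) by (apply clamp_bounds; lra). }
  change (path T A q (fun s => G s (tonelli T G delta A q k (s - delta))) t)
    with (tonelli T G delta A q (S k) t).
  destruct k as [|k]; [simpl in Hk; lra|].
  rewrite <- (Hfix (S k)), <- (Hfix k); symmetry; apply tonelli_stable; [lra|lra|].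
  generalize (clamp_bounds 0 T t); lra.
Qed.

Lemma path_close (T A A' q q' d M : R) (y y' : R -> R) (t : R) :
  0 <= T -> cont y -> cont y' -> Rabs (A - A') <= d -> Rabs (q - q') <= d ->
  (forall s, 0 <= s <= T -> Rabs (y s - y' s) <= M) ->
  Rabs (path T A q y t - path T A' q' y' t) <= d + T * d + T * (T * M).
Proof.
  intros HT Hy Hy' HA Hq HM; unfold path.
  assert (Hc := clamp_bounds 0 T t HT).
  assert (HV := prim2_close y y' M T _ Hy Hy' Hc HM).
  assert (Hqc : Rabs ((q - q') * clamp 0 T t) <= d * T).
  { rewrite Rabs_mult; apply Rmult_le_compat; auto using Rabs_pos.
    rewrite Rabs_pos_eq; lra. }
  apply Rabs_le_between in HA, HV, Hqc; apply Rabs_le_between; lra.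
Qed.

(** Finitely many integrations lead from [(A, q)] to the k-th iterate, so moduli of continuity
    compose. The modulus depends on [k], but not on [A], [q] or [t]. *)
Lemma tonelli_unif_cont T G delta k :
  0 <= T -> superposition G -> unif_cont_snd G ->
  forall e, 0 < e -> exists d, 0 < d /\ forall A q A' q',
    Rabs (A - A') < d -> Rabs (q - q') < d ->
    forall t, Rabs (tonelli T G delta A q k t - tonelli T G delta A' q' k t) < e.
Proof.
  intros HT HGc HGu; induction k as [|k IH]; intros e He.
  - exists e; split; [easy|]; intros; simpl; easy.
  - destruct (HGu (e / (4 * (T * T + 1)))) as (d1 & Hd1 & H1).
    { apply Rdiv_lt_0_compat; nra. }
    destruct (IH d1 Hd1) as (d2 & Hd2 & H2).
    assert (Hd3 : 0 < e / (4 * (T + 1))) by (apply Rdiv_lt_0_compat; lra).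
    exists (Rmin d2 (e / (4 * (T + 1)))); split; [now apply Rmin_pos|].
    intros A q A' q' HA Hq t; simpl.
    assert (Hm1 := Rmin_l d2 (e / (4 * (T + 1)))).
    assert (Hm2 := Rmin_r d2 (e / (4 * (T + 1)))).
    eapply Rle_lt_trans;
      [apply path_close with (d := e / (4 * (T + 1))) (M := e / (4 * (T * T + 1)))|].
    + easy.
    + apply (HGc (fun s => tonelli T G delta A q k (s - delta))).
      now apply cont_shift, cont_tonelli.
    + apply (HGc (fun s => tonelli T G delta A' q' k (s - delta))).
      now apply cont_shift, cont_tonelli.
    + lra.
    + lra.
    + intros s _; apply Rlt_le, H1, H2; lra.
    + assert (E1 : e / (4 * (T + 1)) + T * (e / (4 * (T + 1))) = e / 4) by (field; lra).
      assert (E2 : T * (T * (e / (4 * (T * T + 1)))) = e / 4 - e / (4 * (T * T + 1)))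
        by (field; nra).
      assert (0 < e / (4 * (T * T + 1))) by (apply Rdiv_lt_0_compat; nra).
      lra.
Qed.

(** * Matching initial data given by functionals of the solution *)

Definition sup_lipschitz (T L : R) (l : (R -> R) -> R) : Prop :=
  forall y z M, cont y -> cont z ->
    (forall s, 0 <= s <= T -> Rabs (y s - z s) <= M) ->
    Rabs (l y - l z) <= L * M.

Lemma sup_lipschitz_bound (T L B : R) (l : (R -> R) -> R) :
  sup_lipschitz T L l -> exists C, 0 < C /\ forall y, cont y ->
    (forall s, Rabs (y s) <= B) -> Rabs (l y) < C.
Proof.
  intros Hl; exists (Rabs (l (fun _ => 0)) + Rabs (L * B) + 1); split.
  - generalize (Rabs_pos (l (fun _ => 0))) (Rabs_pos (L * B)); lra.
  - intros y Hy HB.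
    assert (H : Rabs (l y - l (fun _ => 0)) <= L * B).
    { apply Hl; [easy|intros t; apply continuous_const|].
      intros s _; now rewrite Rminus_0_r. }
    generalize (Rabs_triang (l y - l (fun _ => 0)) (l (fun _ => 0))) (Rle_abs (L * B)).
    replace (l y - l (fun _ => 0) + l (fun _ => 0)) with (l y) by ring; lra.
Qed.

(** The map sending [(A, q)] to [(lA y, lq y)], where [y] comes from the retarded solution with data
    [(A, q)], is uniformly continuous, and bounded because [G] is. An approximate fixed point of it
    is the required pair. *)
Lemma retarded_problem (T B L delta e : R) (G : R -> R -> R) (lA lq : (R -> R) -> R) :
  0 < T -> 0 < delta -> 0 < e -> 0 <= L ->
  superposition G -> unif_cont_snd G -> (forall t x, Rabs (G t x) <= B) ->
  sup_lipschitz T L lA -> sup_lipschitz T L lq ->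
  exists A q u, cont u /\
    (forall t, u t = path T A q (fun s => G s (u (s - delta))) t) /\
    Rabs (lA (fun s => G s (u (s - delta))) - A) < e /\
    Rabs (lq (fun s => G s (u (s - delta))) - q) < e.
Proof.
  intros HT Hd He HL HGc HGu HGb HlA Hlq.
  destruct (archimed_cor1 (delta / T)) as (k & Hk & Hk0).
  { now apply Rdiv_lt_0_compat. }
  assert (HkT : T <= INR k * delta).
  { assert (0 < INR k) by (apply lt_0_INR; lia).
    apply Rmult_lt_compat_l with (r := INR k * T) in Hk; [|nra].
    replace (INR k * T * / INR k) with T in Hk by (field; lra).
    replace (INR k * T * (delta / T)) with (INR k * delta) in Hk by (field; lra); lra. }
  set (u := fun A q => tonelli T G delta A q k).
  set (y := fun A q s => G s (u A q (s - delta))).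
  assert (Hyc : forall A q, cont (y A q)).
  { intros A q; apply (HGc (fun s => u A q (s - delta))).
    now apply cont_shift, cont_tonelli. }
  assert (Huc : forall l, sup_lipschitz T L l -> unif_cont2 (fun A q => l (y A q))).
  { intros l Hl e' He'.
    destruct (HGu (e' / (L + 1))) as (d1 & Hd1 & H1).
    { apply Rdiv_lt_0_compat; lra. }
    destruct (tonelli_unif_cont T G delta k ltac:(lra) HGc HGu d1 Hd1) as (d2 & Hd2 & H2).
    exists d2; split; [easy|]; intros A q A' q' HA Hq.
    apply Rle_lt_trans with (L * (e' / (L + 1))).
    - apply Hl; try apply Hyc.
      intros s _; apply Rlt_le, H1, H2; easy.
    - assert (0 < e' / (L + 1)) by (apply Rdiv_lt_0_compat; lra).
      replace (L * (e' / (L + 1))) with (e' - e' / (L + 1)) by (field; lra); lra. }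
  destruct (sup_lipschitz_bound T L B lA HlA) as (C1 & HC1 & B1).
  destruct (sup_lipschitz_bound T L B lq Hlq) as (C2 & HC2 & B2).
  destruct (approx_fixed_point_plane (fun A q => lA (y A q)) (fun A q => lq (y A q))
              (C1 + C2) e) as (A & q & FA & Fq); auto.
  - intros A q.
    assert (H := B1 (y A q) (Hyc A q) (fun s => HGb _ _)); apply Rabs_def2 in H; lra.
  - intros A q.
    assert (H := B2 (y A q) (Hyc A q) (fun s => HGb _ _)); apply Rabs_def2 in H; lra.
  - exists A, q, (u A q); repeat split; auto.
    + now apply cont_tonelli.
    + intros t; now apply tonelli_exact.
Qed.
Lemma path_lipschitz (T B A q : R) (y : R -> R) (s t : R) :
  0 <= T -> cont y -> (forall x, Rabs (y x) <= B) ->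
  Rabs (path T A q y s - path T A q y t) <= (Rabs q + T * B) * Rabs (s - t).
Proof.
  intros HT Hy HB; unfold path.
  assert (Hs := clamp_bounds 0 T s HT). assert (Ht := clamp_bounds 0 T t HT).
  assert (HV : Rabs (prim (prim y) (clamp 0 T s) - prim (prim y) (clamp 0 T t))
               <= T * B * Rabs (clamp 0 T s - clamp 0 T t)).
  { apply prim_lipschitz; [now apply cont_prim|]; intros x Hx.
    apply prim_bound; auto.
    revert Hx; unfold Rmin, Rmax; destruct (Rle_dec _ _); lra. }
  replace (A + q * clamp 0 T s - prim (prim y) (clamp 0 T s)
           - (A + q * clamp 0 T t - prim (prim y) (clamp 0 T t)))
    with (q * (clamp 0 T s - clamp 0 T t)
          + - (prim (prim y) (clamp 0 T s) - prim (prim y) (clamp 0 T t))) by ring.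
  eapply Rle_trans; [apply Rabs_triang|].
  rewrite Rabs_Ropp, Rabs_mult.
  assert (0 <= Rabs q + T * B).
  { generalize (Rabs_pos q) (HB 0) (Rabs_pos (y 0)); nra. }
  apply Rle_trans with ((Rabs q + T * B) * Rabs (clamp 0 T s - clamp 0 T t)); [lra|].
  apply Rmult_le_compat_l; [easy|apply clamp_lipschitz].
Qed.

Lemma path_bound (T B A q : R) (y : R -> R) (t : R) :
  0 <= T -> cont y -> (forall x, Rabs (y x) <= B) ->
  Rabs (path T A q y t) <= Rabs A + T * Rabs q + T * (T * B).
Proof.
  intros HT Hy HB.
  replace (path T A q y t) with (path T A q y t - path T A q y 0 + A)
    by (unfold path; rewrite (clamp_id 0 T 0), prim_0 by lra; ring).
  assert (H := path_lipschitz T B A q y (clamp 0 T t) 0 HT Hy HB).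
  assert (Hc := clamp_bounds 0 T t HT).
  replace (path T A q y (clamp 0 T t)) with (path T A q y t) in H
    by (unfold path; now rewrite (clamp_id 0 T (clamp 0 T t))).
  rewrite Rminus_0_r, (Rabs_pos_eq (clamp 0 T t)) in H by lra.
  eapply Rle_trans; [apply Rabs_triang|].
  assert (0 <= Rabs q + T * B).
  { generalize (Rabs_pos q) (HB 0) (Rabs_pos (y 0)); nra. }
  assert ((Rabs q + T * B) * clamp 0 T t <= (Rabs q + T * B) * T)
    by (apply Rmult_le_compat_l; lra).
  lra.
Qed.

(** Delay and matching error are both [/ INR (S n)]. The data [A n] and [q n] stay bounded, so the
    retarded solutions share a Lipschitz constant; [lA] and [lq] are continuous for uniform
    convergence, so a cluster point matches them exactly. *)
Lemma functional_bvp_solvable (T B L : R) (G : R -> R -> R) (lA lq : (R -> R) -> R) :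
  0 < T -> 0 <= L ->
  superposition G -> unif_cont_snd G -> (forall t x, Rabs (G t x) <= B) ->
  sup_lipschitz T L lA -> sup_lipschitz T L lq ->
  exists u, cont u /\
    forall t, u t = path T (lA (fun s => G s (u s))) (lq (fun s => G s (u s)))
                      (fun s => G s (u s)) t.
Proof.
  intros HT HL HGc HGu HGb HlA Hlq.
  assert (HB : 0 <= B) by (generalize (HGb 0 0) (Rabs_pos (G 0 0)); lra).
  set (d := fun n : nat => / INR (S n)).
  assert (Hd : forall n, 0 < d n).
  { intros n; apply Rinv_0_lt_compat, lt_0_INR; lia. }
  assert (Hd1 : forall n, d n <= 1).
  { intros n; unfold d; rewrite <- Rinv_1; apply Rinv_le_contravar; [lra|].
    rewrite S_INR; generalize (pos_INR n); lra. }
  assert (Hsol : forall n, exists p : R * R * (R -> R), let '(A, q, u) := p in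
     cont u /\ (forall t, u t = path T A q (fun s => G s (u (s - d n))) t) /\
     Rabs (lA (fun s => G s (u (s - d n))) - A) < d n /\
     Rabs (lq (fun s => G s (u (s - d n))) - q) < d n).
  { intros n.
    destruct (retarded_problem T B L (d n) (d n) G lA lq) as (A & q & u & H); auto.
    exists (A, q, u); exact H. }
  destruct (choice _ Hsol) as [p Hp].
  set (A := fun n => fst (fst (p n))). set (q := fun n => snd (fst (p n))).
  set (u := fun n => snd (p n)). set (y := fun n s => G s (u n (s - d n))).
  assert (Hu : forall n, cont (u n) /\ (forall t, u n t = path T (A n) (q n) (y n) t) /\
     Rabs (lA (y n) - A n) < d n /\ Rabs (lq (y n) - q n) < d n).
  { intros n; generalize (Hp n); unfold y, u, A, q.
    destruct (p n) as [[A' q'] u']; easy. }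
  clearbody A q u; clear p Hp Hsol.
  assert (Hyc : forall n, cont (y n)).
  { intros n; apply (HGc (fun s => u n (s - d n))), cont_shift, Hu. }
  destruct (sup_lipschitz_bound T L B lA HlA) as (C1 & HC1 & B1).
  destruct (sup_lipschitz_bound T L B lq Hlq) as (C2 & HC2 & B2).
  assert (BA : forall n, Rabs (A n) <= C1 + 1).
  { intros n; destruct (Hu n) as (_ & _ & H & _).
    assert (H1 := B1 (y n) (Hyc n) (fun s => HGb _ _)).
    generalize (Hd1 n); intros; apply Rabs_def2 in H, H1; apply Rabs_le_between; lra. }
  assert (Bq : forall n, Rabs (q n) <= C2 + 1).
  { intros n; destruct (Hu n) as (_ & _ & _ & H).
    assert (H1 := B2 (y n) (Hyc n) (fun s => HGb _ _)).
    generalize (Hd1 n); intros; apply Rabs_def2 in H, H1; apply Rabs_le_between; lra. }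
  set (L0 := C2 + 1 + T * B).
  assert (HL0 : 0 <= L0) by (unfold L0; nra).
  destruct (equilipschitz_cluster T L0 (C1 + 1 + T * (C2 + 1) + T * (T * B)) u)
    as (v & Hv & Hclus); [lra|easy| | |].
  { intros n t _; destruct (Hu n) as (_ & -> & _).
    eapply Rle_trans; [apply (path_bound T B); auto; [lra|intros; apply HGb]|].
    generalize (BA n) (Bq n); intros; nra. }
  { intros n s t _ _; destruct (Hu n) as (_ & E & _); rewrite !E.
    eapply Rle_trans; [apply (path_lipschitz T B); auto; [lra|intros; apply HGb]|].
    apply Rmult_le_compat_r; [apply Rabs_pos|unfold L0; generalize (Bq n); lra]. }
  (* The delayed argument [s - d n] may be negative, so the limit is frozen outside [[0,T]] as paths
     are. *)
  set (w := fun t => v (clamp 0 T t)).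
  assert (Hw : forall s t, Rabs (w s - w t) <= L0 * Rabs (s - t)).
  { intros s t; unfold w; eapply Rle_trans; [apply Hv; apply clamp_bounds; lra|].
    apply Rmult_le_compat_l; [easy|apply clamp_lipschitz]. }
  assert (Hwc := lipschitz_cont w L0 Hw).
  exists w; split; [easy|]; intros t.
  set (yw := fun s => G s (w s)).
  assert (Hyw : cont yw) by (apply (HGc w); easy).
  apply Rminus_diag_uniq, Rabs_eq_0, Rle_antisym; [|apply Rabs_pos].
  apply le_epsilon; intros e He; rewrite Rplus_0_l.
  (* [K * M] is the total error: [M] between [u n] and [w], [(1 + L) * M] for each of [A] and [q],
     the latter multiplied by a time at most [T], and [T * (T * M)] for the double primitive. *)
  set (K := 1 + (1 + L) * (1 + T) + T * T).
  assert (HK : 1 <= K) by (unfold K; nra).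
  set (M := e / K).
  assert (HM : 0 < M) by (apply Rdiv_lt_0_compat; lra).
  destruct (HGu M HM) as (r & Hr & HGr).
  (* The first bound absorbs the matching error; the second makes the shift by the delay cost at
     most [r / 2] in the argument of [G], the other half being the distance from [u n] to [w]. *)
  assert (Hmin : 0 < Rmin M (r / (2 * (L0 + 1)))).
  { apply Rmin_pos; [easy|apply Rdiv_lt_0_compat; lra]. }
  destruct (archimed_cor1 _ Hmin) as (N & HN & HN0).
  destruct (Hclus (Rmin M (r / 2)) N) as (n & Hn & Hclose); [apply Rmin_pos; lra|].
  assert (Hdn : d n < Rmin M (r / (2 * (L0 + 1)))).
  { eapply Rle_lt_trans; [|exact HN]; apply Rinv_le_contravar.
    - apply lt_0_INR; lia.
    - apply le_INR; lia. }
  assert (HdM : d n < M) by (generalize (Rmin_l M (r / (2 * (L0 + 1)))); lra).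
  assert (Hdr : L0 * d n <= r / 2).
  { assert (d n < r / (2 * (L0 + 1))) by (generalize (Rmin_r M (r / (2 * (L0 + 1)))); lra).
    assert ((L0 + 1) * d n <= (L0 + 1) * (r / (2 * (L0 + 1))))
      by (apply Rmult_le_compat_l; lra).
    replace ((L0 + 1) * (r / (2 * (L0 + 1)))) with (r / 2) in * by (field; lra).
    generalize (Hd n); lra. }
  destruct (Hu n) as (_ & Eu & EA & Eq).
  assert (Huw : forall s, Rabs (u n s - w s) < Rmin M (r / 2)).
  { intros s; replace (u n s) with (u n (clamp 0 T s)).
    - apply Hclose, clamp_bounds; lra.
    - rewrite !Eu; unfold path.
      now rewrite (clamp_id 0 T (clamp 0 T s)) by (apply clamp_bounds; lra). }
  assert (Hyy : forall s, 0 <= s <= T -> Rabs (y n s - yw s) <= M).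
  { intros s _; apply Rlt_le, HGr.
    assert (H1 := Huw (s - d n)). assert (H2 := Hw (s - d n) s).
    replace (s - d n - s) with (- d n) in H2 by ring.
    rewrite Rabs_Ropp, (Rabs_pos_eq (d n)) in H2 by (apply Rlt_le, Hd).
    generalize (Rmin_r M (r / 2)); intros.
    apply Rabs_def2 in H1; apply Rabs_le_between in H2; apply Rabs_def1; lra. }
  assert (HA' : Rabs (A n - lA yw) <= (1 + L) * M).
  { assert (H := HlA (y n) yw M (Hyc n) Hyw Hyy).
    apply Rabs_def2 in EA; apply Rabs_le_between in H; apply Rabs_le_between; lra. }
  assert (Hq' : Rabs (q n - lq yw) <= (1 + L) * M).
  { assert (H := Hlq (y n) yw M (Hyc n) Hyw Hyy).
    apply Rabs_def2 in Eq; apply Rabs_le_between in H; apply Rabs_le_between; lra. }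
  assert (H1 := path_close T (A n) (lA yw) (q n) (lq yw) _ M (y n) yw t
                  ltac:(lra) (Hyc n) Hyw HA' Hq' Hyy).
  rewrite <- Eu in H1.
  assert (H2 := Huw t). generalize (Rmin_l M (r / 2)); intros H3.
  assert (HKM : K * M = e) by (unfold M; field; lra).
  unfold K in HKM.
  apply Rabs_le_between in H1; apply Rabs_def2 in H2; apply Rabs_le_between; lra.
Qed.
(** * The linear boundary value problem *)

Lemma RInt_of_derive (P p : R -> R) (a b : R) :
  (forall s, is_derive P s (p s)) -> cont p -> RInt p a b = P b - P a.
Proof.
  intros HP Hp; apply (is_RInt_unique p a b).
  exact (is_RInt_derive P p a b (fun s _ => HP s) (fun s _ => Hp s)).
Qed.

Lemma sup_lipschitz_prims (T eta k1 k2 k3 : R) :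
  0 <= eta <= T ->
  exists L, 0 <= L /\ sup_lipschitz T L
    (fun y => k1 * prim (prim y) T + k2 * prim (prim y) eta
              + k3 * prim (prim (prim y)) eta).
Proof.
  intros He.
  exists ((Rabs k1 + Rabs k2) * (T * T) + Rabs k3 * (T * (T * T))); split.
  { assert (H1 := Rabs_pos k1); assert (H2 := Rabs_pos k2); assert (H3 := Rabs_pos k3).
    apply Rplus_le_le_0_compat; repeat apply Rmult_le_pos; lra. }
  intros y z M Hy Hz HM.
  assert (V1 := prim2_close y z M T T Hy Hz ltac:(lra) HM).
  assert (V2 := prim2_close y z M T eta Hy Hz He HM).
  assert (V3 : Rabs (prim (prim (prim y)) eta - prim (prim (prim z)) eta)
               <= T * (T * (T * M))).
  { apply prim_close; auto using cont_prim; intros; now apply prim2_close. }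
  assert (mul : forall k x C, Rabs x <= C -> Rabs (k * x) <= Rabs k * C).
  { intros k x C Hx; rewrite Rabs_mult; apply Rmult_le_compat_l; auto using Rabs_pos. }
  apply (mul k1) in V1; apply (mul k2) in V2; apply (mul k3) in V3.
  apply Rabs_le_between in V1, V2, V3; apply Rabs_le_between; lra.
Qed.

Lemma sup_lipschitz_le (T L L' : R) (l : (R -> R) -> R) :
  0 <= T -> L <= L' -> sup_lipschitz T L l -> sup_lipschitz T L' l.
Proof.
  intros HT HL Hl y z M Hy Hz HM; eapply Rle_trans; [exact (Hl y z M Hy Hz HM)|].
  apply Rmult_le_compat_r; [|easy].
  generalize (HM 0 ltac:(lra)) (Rabs_pos (y 0 - z 0)); lra.
Qed.

(** Twice the determinant of the boundary system in [(A, q)]; also the numerator of both [Lambda1]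
    and [Lambda2]. *)
Definition bvp_det (T eta alpha beta : R) : R :=
  (2 * T - alpha * eta ^ 2) - beta * (alpha * eta ^ 2 - 2 * eta + 2 * T).

(* [(bvp_A y, bvp_q y)] is the solution, by Cramer's rule, of the linear system
   that the boundary conditions impose on [u t = A + q t - int_0^t (t-s) y]. *)
Definition bvp_A (T eta alpha beta : R) (y : R -> R) : R :=
  2 * beta * eta / bvp_det T eta alpha beta * prim (prim y) T
  + - beta * (2 * T - alpha * eta ^ 2) / bvp_det T eta alpha beta * prim (prim y) eta
  + - 2 * alpha * beta * eta / bvp_det T eta alpha beta * prim (prim (prim y)) eta.

Definition bvp_q (T eta alpha beta : R) (y : R -> R) : R :=
  2 * (1 - beta) / bvp_det T eta alpha beta * prim (prim y) T
  + 2 * beta * (1 - alpha * eta) / bvp_det T eta alpha beta * prim (prim y) eta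
  + - 2 * alpha * (1 - beta) / bvp_det T eta alpha beta * prim (prim (prim y)) eta.

Definition bvp_sol (T eta alpha beta : R) (y : R -> R) (t : R) : R :=
  bvp_A T eta alpha beta y + bvp_q T eta alpha beta y * t - prim (prim y) t.

Lemma is_derive_bvp_sol T eta alpha beta y t : cont y ->
  is_derive (bvp_sol T eta alpha beta y) t (bvp_q T eta alpha beta y - prim y t).
Proof.
  intros Hy; unfold bvp_sol.
  apply (is_derive_minus (fun t => bvp_A T eta alpha beta y + bvp_q T eta alpha beta y * t)).
  - auto_derive; [easy|ring].
  - now apply is_derive_prim, cont_prim.
Qed.

Lemma is_derive2_bvp_sol T eta alpha beta y t : cont y ->
  is_derive (Derive (bvp_sol T eta alpha beta y)) t (- y t).
Proof.
  intros Hy.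
  apply is_derive_ext with (fun t => bvp_q T eta alpha beta y - prim y t).
  - intros s; symmetry; apply is_derive_unique; now apply is_derive_bvp_sol.
  - replace (- y t) with (minus 0 (y t)) by (unfold minus, plus, opp; simpl; ring).
    apply (is_derive_minus (fun _ => bvp_q T eta alpha beta y)).
    + apply (is_derive_const (K := R_AbsRing) (V := R_NormedModule)).
    + now apply is_derive_prim.
Qed.

Lemma cont_bvp_sol T eta alpha beta y : cont y -> cont (bvp_sol T eta alpha beta y).
Proof.
  intros Hy t; apply (ex_derive_continuous (bvp_sol T eta alpha beta y)).
  eexists; now apply is_derive_bvp_sol.
Qed.

Lemma RInt_bvp_sol T eta alpha beta y t : cont y ->
  RInt (bvp_sol T eta alpha beta y) 0 t
  = bvp_A T eta alpha beta y * t + bvp_q T eta alpha beta y * t ^ 2 / 2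
    - prim (prim (prim y)) t.
Proof.
  intros Hy.
  set (A := bvp_A T eta alpha beta y); set (q := bvp_q T eta alpha beta y).
  set (P := fun t => A * t + q * t ^ 2 / 2 - prim (prim (prim y)) t).
  replace (A * t + q * t ^ 2 / 2 - prim (prim (prim y)) t) with (P t - P 0)
    by (unfold P; rewrite prim_0; field).
  apply RInt_of_derive; [|now apply cont_bvp_sol].
  - intros s; unfold P, bvp_sol.
    apply (is_derive_minus (fun t => A * t + q * t ^ 2 / 2)).
    + auto_derive; [easy|unfold A, q; field].
    + now apply is_derive_prim, cont_prim, cont_prim.
Qed.

Lemma bvp_sol_left T eta alpha beta y : bvp_det T eta alpha beta <> 0 ->
  bvp_sol T eta alpha beta y 0 = beta * bvp_sol T eta alpha beta y eta.
Proof.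
  intros Hd; unfold bvp_sol, bvp_A, bvp_q; rewrite (prim_0 (prim y)).
  generalize Hd; unfold bvp_det; intros; field; easy.
Qed.

Lemma bvp_sol_right T eta alpha beta y : cont y -> bvp_det T eta alpha beta <> 0 ->
  bvp_sol T eta alpha beta y T = alpha * RInt (bvp_sol T eta alpha beta y) 0 eta.
Proof.
  intros Hy Hd; rewrite RInt_bvp_sol by easy; unfold bvp_sol, bvp_A, bvp_q.
  generalize Hd; unfold bvp_det; intros; field; easy.
Qed.

(** * Concavity, sign and size of the solution for a nonnegative right-hand side *)

Lemma nondecreasing_of_derive_nonneg (h dh : R -> R) (a b : R) :
  a <= b -> (forall t, is_derive h t (dh t)) -> (forall t, a <= t <= b -> 0 <= dh t) ->
  h a <= h b.
Proof.
  intros Hab Hd Hp.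
  destruct (MVT_gen h a b dh) as (c & Hc & E).
  - auto.
  - intros x _; apply continuity_pt_filterlim, (ex_derive_continuous h).
    now exists (dh x).
  - rewrite Rmin_left, Rmax_right in Hc by easy.
    generalize (Hp c Hc); nra.
Qed.

Lemma prim_nonneg (y : R -> R) (t : R) :
  cont y -> 0 <= t -> (forall s, 0 <= s <= t -> 0 <= y s) -> 0 <= prim y t.
Proof.
  intros Hy Ht Hp; rewrite <- (prim_0 y).
  apply nondecreasing_of_derive_nonneg with y; auto; intros; now apply is_derive_prim.
Qed.

Lemma prim_le_mul_right (z : R -> R) (dz : R -> R) (t : R) :
  0 <= t -> (forall s, is_derive z s (dz s)) -> (forall s, 0 <= s <= t -> 0 <= dz s) ->
  prim z t <= t * z t.
Proof.
  intros Ht Hz Hp.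
  assert (Hc : cont z) by (intros s; apply (ex_derive_continuous z); now exists (dz s)).
  enough (0 * z 0 - prim z 0 <= t * z t - prim z t) by (rewrite prim_0 in H; lra).
  apply (nondecreasing_of_derive_nonneg (fun t => t * z t - prim z t) (fun t => t * dz t)).
  - easy.
  - intros s; replace (s * dz s) with (minus (1 * z s + s * dz s) (z s))
      by (unfold minus, plus, opp; simpl; ring).
    apply (is_derive_minus (fun t => t * z t)); [|now apply is_derive_prim].
    apply (is_derive_mult (fun t => t) z).
    + apply (is_derive_id (K := R_AbsRing)).
    + apply Hz.
    + intros; apply Rmult_comm.
  - intros s Hs; apply Rmult_le_pos; [lra|]; apply Hp; lra.
Qed.

(** The primitive of a nondecreasing [w] is convex and vanishes at 0, so its graph lies below the
    chord and its integral below the area of a triangle. *)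
Lemma prim2_le_half (w : R -> R) (dw : R -> R) (t : R) :
  0 <= t -> (forall s, is_derive w s (dw s)) -> (forall s, 0 <= s <= t -> 0 <= dw s) ->
  2 * prim (prim w) t <= t * prim w t.
Proof.
  intros Ht Hw Hp.
  assert (Hc : cont w) by (intros s; apply (ex_derive_continuous w); now exists (dw s)).
  enough (0 * prim w 0 - 2 * prim (prim w) 0 <= t * prim w t - 2 * prim (prim w) t)
    by (rewrite !prim_0 in H; lra).
  apply (nondecreasing_of_derive_nonneg (fun t => t * prim w t - 2 * prim (prim w) t)
           (fun t => t * w t - prim w t)).
  - easy.
  - intros s; replace (s * w s - prim w s)
      with (minus (1 * prim w s + s * w s) (2 * prim w s))
      by (unfold minus, plus, opp; simpl; ring).
    apply (is_derive_minus (fun t => t * prim w t)).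
    + apply (is_derive_mult (fun t => t) (prim w)).
      * apply (is_derive_id (K := R_AbsRing)).
      * now apply is_derive_prim.
      * intros; apply Rmult_comm.
    + apply (is_derive_scal (prim (prim w))); now apply is_derive_prim, cont_prim.
  - intros s Hs.
    enough (prim w s <= s * w s) by lra.
    apply prim_le_mul_right with dw; auto; try lra; intros; apply Hp; lra.
Qed.

Lemma cont_rsub (T : R) : cont (fun s => T - s).
Proof.
  intros s; apply (continuous_minus (fun _ : R => T));
    [apply continuous_const|apply continuous_id].
Qed.

Lemma cont_moment (y : R -> R) (T : R) : cont y -> cont (fun s => (T - s) * y s).
Proof.
  intros Hy s; apply (continuous_mult (fun s => T - s) y); [apply cont_rsub|apply Hy].
Qed.

(** Integration by parts; it links the weighted integrals in [Lambda1] and [Lambda2] to the iterated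
    primitives in [bvp_sol]. *)
Lemma RInt_moment (y : R -> R) (T x : R) : cont y ->
  RInt (fun s => (T - s) * y s) x T
  = prim (prim y) T - prim (prim y) x - (T - x) * prim y x.
Proof.
  intros Hy.
  set (P := fun s => (T - s) * prim y s + prim (prim y) s).
  replace (prim (prim y) T - prim (prim y) x - (T - x) * prim y x)
    with (P T - P x) by (unfold P; ring).
  apply RInt_of_derive.
  - intros s; unfold P.
    replace ((T - s) * y s) with (plus ((- 1) * prim y s + (T - s) * y s) (prim y s))
      by (unfold plus; simpl; ring).
    apply (is_derive_plus (fun s => (T - s) * prim y s)).
    + apply (is_derive_mult (fun s => T - s) (prim y)).
      * auto_derive; [easy|ring].
      * now apply is_derive_prim.
      * intros; apply Rmult_comm.
    + now apply is_derive_prim, cont_prim.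
  - now apply cont_moment.
Qed.

(** The mean slopes over [[a,b]] and [[b,c]] are values of the derivative, which is nonincreasing as
    [y >= 0]. The form without division also covers [a = b] and [b = c]. *)
Lemma bvp_sol_concave T eta alpha beta y a b c :
  cont y -> (forall s, 0 <= s <= T -> 0 <= y s) -> 0 <= a <= b -> b <= c <= T ->
  (c - b) * bvp_sol T eta alpha beta y a + (b - a) * bvp_sol T eta alpha beta y c
  <= (c - a) * bvp_sol T eta alpha beta y b.
Proof.
  intros Hy Hp Hab Hbc.
  set (u := bvp_sol T eta alpha beta y).
  set (du := fun s => bvp_q T eta alpha beta y - prim y s).
  assert (Hu : forall s, is_derive u s (du s)) by (intros; now apply is_derive_bvp_sol).
  assert (Hu' : forall s, continuity_pt u s)
    by (intros; now apply continuity_pt_filterlim, cont_bvp_sol).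
  destruct (MVT_gen u a b du) as (m1 & Hm1 & E1); auto.
  destruct (MVT_gen u b c du) as (m2 & Hm2 & E2); auto.
  rewrite Rmin_left, Rmax_right in Hm1, Hm2 by lra.
  assert (prim y m1 <= prim y m2).
  { apply nondecreasing_of_derive_nonneg with y; [lra|intros; now apply is_derive_prim|].
    intros; apply Hp; lra. }
  assert (du m2 <= du m1) by (unfold du; lra).
  replace ((c - a) * u b) with ((c - b) * (u a + du m1 * (b - a))
                                + (b - a) * (u c - du m2 * (c - b)))
    by (rewrite <- E1, <- E2; ring).
  assert (0 <= (c - b) * (b - a) * (du m1 - du m2))
    by (repeat apply Rmult_le_pos; lra).
  lra.
Qed.

(** In [D u(eta)] the contributions of [beta] cancel. With [W], [V], [Z] the first, second and third
    primitive of [y] at [eta], the right side minus the left side is [2 (T - eta) (eta W - V) +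
    alpha eta (eta V - 2 Z)], and both brackets are nonnegative. *)
Lemma bvp_sol_eta_lower T eta alpha beta y :
  0 < eta < T -> 0 < alpha -> 0 < bvp_det T eta alpha beta ->
  cont y -> (forall s, 0 <= s <= T -> 0 <= y s) ->
  2 * eta * RInt (fun s => (T - s) * y s) eta T
  <= bvp_det T eta alpha beta * bvp_sol T eta alpha beta y eta.
Proof.
  intros He Ha HD Hy Hp; rewrite RInt_moment by easy.
  assert (E : bvp_det T eta alpha beta * bvp_sol T eta alpha beta y eta
    = 2 * eta * prim (prim y) T - (2 * T - alpha * eta ^ 2) * prim (prim y) eta
      - 2 * alpha * eta * prim (prim (prim y)) eta).
  { unfold bvp_sol, bvp_A, bvp_q; revert HD; unfold bvp_det; intros; field; lra. }
  assert (H1 : prim (prim y) eta <= eta * prim y eta).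
  { apply prim_le_mul_right with y; [lra|intros; now apply is_derive_prim|].
    intros; apply Hp; lra. }
  assert (H2 : 2 * prim (prim (prim y)) eta <= eta * prim (prim y) eta).
  { apply prim2_le_half with y; [lra|intros; now apply is_derive_prim|].
    intros; apply Hp; lra. }
  assert (0 <= (T - eta) * (eta * prim y eta - prim (prim y) eta))
    by (apply Rmult_le_pos; lra).
  assert (0 <= alpha * eta * (eta * prim (prim y) eta - 2 * prim (prim (prim y)) eta)).
  { apply Rmult_le_pos; [apply Rmult_le_pos; lra|lra]. }
  rewrite E; simpl (_ ^ 2); lra.
Qed.

(** The solution lies above its chord on [[0,eta]], so the integral in the condition at [T] is at
    least the area of the trapezoid with heights [u 0 = beta u(eta)] and [u(eta)]. *)
Lemma bvp_sol_right_lower T eta alpha beta y :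
  0 < eta < T -> 0 < alpha -> bvp_det T eta alpha beta <> 0 ->
  cont y -> (forall s, 0 <= s <= T -> 0 <= y s) ->
  alpha * (beta + 1) * eta / 2 * bvp_sol T eta alpha beta y eta
  <= bvp_sol T eta alpha beta y T.
Proof.
  intros He Ha HD Hy Hp.
  rewrite bvp_sol_right by easy.
  apply Rle_trans with (alpha * (eta / 2 * (bvp_sol T eta alpha beta y 0
                                            + bvp_sol T eta alpha beta y eta))).
  { rewrite bvp_sol_left by easy; right; field. }
  apply Rmult_le_compat_l; [lra|].
  rewrite RInt_bvp_sol by easy; unfold bvp_sol; rewrite prim_0.
  assert (H2 : 2 * prim (prim (prim y)) eta <= eta * prim (prim y) eta).
  { apply prim2_le_half with y; [lra|intros; now apply is_derive_prim|].
    intros; apply Hp; lra. }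
  lra.
Qed.

(** Nonnegativity starts at [eta], reaches [0] and [T] through the boundary conditions, and spreads
    to the other points by concavity. *)
Lemma bvp_sol_nonneg T eta alpha beta y t :
  0 < eta < T -> 0 < alpha -> 0 <= beta -> 0 < bvp_det T eta alpha beta ->
  cont y -> (forall s, 0 <= s <= T -> 0 <= y s) -> 0 <= t <= T ->
  0 <= bvp_sol T eta alpha beta y t.
Proof.
  intros He Ha Hb HD Hy Hp Ht.
  assert (H1 := bvp_sol_eta_lower T eta alpha beta y He Ha HD Hy Hp).
  assert (H2 := bvp_sol_right_lower T eta alpha beta y He Ha ltac:(lra) Hy Hp).
  assert (H3 := bvp_sol_left T eta alpha beta y ltac:(lra)).
  assert (H4 : 0 <= RInt (fun s => (T - s) * y s) eta T).
  { rewrite <- (Rmult_0_r (T - eta)), <- (RInt_const (V := R_CompleteNormedModule)).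
    apply RInt_le; [lra|apply ex_RInt_const| |].
    - now apply cont_ex_RInt, cont_moment.
    - intros s Hs; apply Rmult_le_pos; [lra|apply Hp; lra]. }
  assert (H5 := bvp_sol_concave T eta alpha beta y 0 t T Hy Hp ltac:(lra) ltac:(lra)).
  set (u := bvp_sol T eta alpha beta y) in *.
  assert (0 <= u eta).
  { apply Rmult_le_reg_l with (bvp_det T eta alpha beta); [easy|nra]. }
  assert (0 <= u 0) by nra.
  assert (0 <= u T).
  { eapply Rle_trans; [|exact H2]; apply Rmult_le_pos; [|easy].
    apply Rmult_le_pos; [apply Rmult_le_pos; nra|lra]. }
  assert (0 <= (T - t) * u 0) by (apply Rmult_le_pos; lra).
  assert (0 <= (t - 0) * u T) by (apply Rmult_le_pos; lra).
  apply Rmult_le_reg_l with (T - 0); lra.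
Qed.

Lemma bvp_sol_upper T eta alpha beta y t :
  0 < eta < T -> 0 < alpha -> 0 <= beta -> 0 < bvp_det T eta alpha beta ->
  cont y -> (forall s, 0 <= s <= T -> 0 <= y s) -> 0 <= t <= T ->
  bvp_det T eta alpha beta * bvp_sol T eta alpha beta y t
  <= (2 * (beta + 1) + / T * beta * eta * (alpha * eta + 2) + alpha * beta * T)
     * (T * prim (prim y) T).
Proof.
  intros He Ha Hb HD Hy Hp Ht.
  set (D := bvp_det T eta alpha beta) in *.
  assert (HW : forall s, 0 <= s <= T -> 0 <= prim y s).
  { intros s Hs; apply prim_nonneg; [easy|lra|intros; apply Hp; lra]. }
  assert (HV : forall s, 0 <= s <= T -> 0 <= prim (prim y) s).
  { intros s Hs; apply prim_nonneg; [now apply cont_prim|lra|intros; apply HW; lra]. }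
  assert (HVe := HV eta ltac:(lra)).
  assert (HVt := HV t Ht).
  assert (HVT : prim (prim y) eta <= prim (prim y) T).
  { apply nondecreasing_of_derive_nonneg with (prim y); [lra| |].
    - intros; now apply is_derive_prim, cont_prim.
    - intros; apply HW; lra. }
  assert (HZ : 0 <= prim (prim (prim y)) eta).
  { apply prim_nonneg; [now apply cont_prim, cont_prim|lra|intros; apply HV; lra]. }
  assert (HZ2 : 2 * prim (prim (prim y)) eta <= eta * prim (prim y) eta).
  { apply prim2_le_half with y; [lra|intros; now apply is_derive_prim|].
    intros; apply Hp; lra. }
  assert (E : D * bvp_sol T eta alpha beta y t
    = (beta * (alpha * eta ^ 2 - 2 * T) + 2 * beta * (1 - alpha * eta) * t)
        * prim (prim y) eta
      + alpha * ((beta - 1) * t - beta * eta) * (2 * prim (prim (prim y)) eta)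
      + (2 * (1 - beta) * t + 2 * beta * eta) * prim (prim y) T - D * prim (prim y) t).
  { unfold D; unfold bvp_sol, bvp_A, bvp_q; revert HD; unfold D, bvp_det; intros; field; lra. }
  set (VT := prim (prim y) T) in *. set (Ve := prim (prim y) eta) in *.
  set (Z := prim (prim (prim y)) eta) in *. set (Vt := prim (prim y) t) in *.
  assert (HVT0 : 0 <= VT) by lra.
  replace ((2 * (beta + 1) + / T * beta * eta * (alpha * eta + 2) + alpha * beta * T)
     * (T * VT)) with ((2 * (beta + 1) * T + beta * eta * (alpha * eta + 2)
                        + alpha * beta * T ^ 2) * VT) by (field; lra).
  assert (HZT : 2 * Z <= T * VT) by nra.
  assert (0 <= D * Vt) by nra.
  (* The bracket in [Lambda1], times [T], is the sum of [beta alpha eta^2], [alpha beta T^2] and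
     [2 (beta + 1) T + 2 beta eta], which bound the terms in [Ve], [Z] and [VT] respectively; the
     term in [Vt] has a favourable sign. *)
  assert (T1 : (beta * (alpha * eta ^ 2 - 2 * T) + 2 * beta * (1 - alpha * eta) * t) * Ve
               <= beta * alpha * eta ^ 2 * VT).
  { apply Rle_trans with (beta * alpha * eta ^ 2 * Ve).
    - apply Rmult_le_compat_r; [easy|].
      assert (0 <= beta * (T - t)) by nra.
      assert (0 <= beta * (alpha * eta * t)).
      { repeat apply Rmult_le_pos; lra. }
      lra.
    - apply Rmult_le_compat_l; [|easy].
      repeat apply Rmult_le_pos; try lra; apply pow2_ge_0. }
  assert (T2 : alpha * ((beta - 1) * t - beta * eta) * (2 * Z)
               <= alpha * beta * T ^ 2 * VT).
  { apply Rle_trans with (alpha * beta * T * (2 * Z)).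
    - apply Rmult_le_compat_r; [lra|].
      assert (0 <= alpha * (t + beta * (T - t) + beta * eta)).
      { apply Rmult_le_pos; nra. }
      lra.
    - replace (alpha * beta * T ^ 2 * VT) with (alpha * beta * T * (T * VT)) by ring.
      apply Rmult_le_compat_l; [|easy].
      repeat apply Rmult_le_pos; lra. }
  assert (T3 : (2 * (1 - beta) * t + 2 * beta * eta) * VT
               <= (2 * (beta + 1) * T + 2 * beta * eta) * VT).
  { apply Rmult_le_compat_r; [easy|]; nra. }
  rewrite E; lra.
Qed.

(** * The truncated problem *)

Lemma cont_Rmax (g h : R -> R) : cont g -> cont h -> cont (fun s => Rmax (g s) (h s)).
Proof.
  intros Hg Hh t.
  apply continuous_ext with (fun s => (g s + h s + Rabs (g s - h s)) * / 2).
  - intros s; unfold Rmax, Rabs; destruct (Rle_dec _ _), (Rcase_abs _); lra.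
  - apply (continuous_mult (fun s => g s + h s + Rabs (g s - h s)));
      [|apply continuous_const].
    apply (continuous_plus (fun s => g s + h s)).
    + now apply (continuous_plus g h).
    + apply continuous_Rabs_comp.
      now apply (continuous_minus g h).
Qed.

Lemma cont_comp (g x : R -> R) : cont g -> cont x -> cont (fun s => g (x s)).
Proof. intros Hg Hx t; apply (continuous_comp x g); [apply Hx|apply Hg]. Qed.

Lemma cont_clamp_comp (lo x : R -> R) (hi : R) :
  cont lo -> cont x -> cont (fun s => clamp (lo s) hi (x s)).
Proof.
  intros Hl Hx; unfold clamp; apply cont_Rmax; [easy|].
  assert (Hopp : cont Ropp).
  { intros t; apply (continuous_opp (fun s : R => s)), continuous_id. }
  intros t; apply continuous_ext with (fun s => - Rmax (- x s) (- hi)).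
  - intros s; unfold Rmax, Rmin; destruct (Rle_dec _ _), (Rle_dec _ _); lra.
  - revert t; apply (cont_comp Ropp (fun s => Rmax (- x s) (- hi))); [easy|].
    apply (cont_Rmax (fun s => - x s) (fun _ => - hi)).
    + now apply (cont_comp Ropp x).
    + intros t; apply continuous_const.
Qed.

Lemma continuous_on_clamp (D : R -> Prop) (g : R -> R) (lo hi : R) :
  lo <= hi -> continuous_on D g -> (forall x, lo <= x <= hi -> D x) ->
  cont (fun t => g (clamp lo hi t)).
Proof.
  intros H Hg HD t.
  apply (filterlim_comp _ _ _ (clamp lo hi) g _ (within D (locally (clamp lo hi t)))).
  - intros P HP; unfold filtermap.
    apply (filter_imp (fun s => D (clamp lo hi s) -> P (clamp lo hi s))).
    + intros s Hs; apply Hs, HD, clamp_bounds, H.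
    + exact (cont_clamp lo hi t _ HP).
  - apply Hg, HD, clamp_bounds, H.
Qed.

Lemma cont_bounded (g : R -> R) (lo hi : R) :
  lo <= hi -> cont g -> exists B, 0 < B /\ forall x, lo <= x <= hi -> Rabs (g x) <= B.
Proof.
  intros H Hg.
  destruct (continuity_ab_maj (fun x => Rabs (g x)) lo hi H) as (m & Hm & _).
  - intros x _; apply continuity_pt_filterlim.
    now apply (continuous_Rabs_comp g).
  - exists (Rabs (g m) + 1); split; [generalize (Rabs_pos (g m)); lra|].
    intros x Hx; generalize (Hm x Hx); lra.
Qed.

(** The point [t0] may be an endpoint, where the weight may vanish, so positivity is taken from a
    nondegenerate interval [[p,q]] containing [t0]. *)
Lemma RInt_weight_pos (k h : R -> R) (lo hi t0 : R) :
  lo < hi -> cont k -> cont h -> (forall s, lo < s < hi -> 0 < k s) ->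
  (forall s, lo <= s <= hi -> 0 <= h s) -> lo <= t0 <= hi -> 0 < h t0 ->
  0 < RInt (fun s => k s * h s) lo hi.
Proof.
  intros Hlh Hk Hh Pk Ph Ht0 P0.
  assert (Hkh : cont (fun s => k s * h s)) by (intros s; now apply (continuous_mult k h)).
  assert (Hnn : forall s, lo < s < hi -> 0 <= k s * h s).
  { intros s Hs; apply Rmult_le_pos; [now apply Rlt_le, Pk|apply Ph; lra]. }
  destruct (proj1 (filterlim_locally h (h t0)) (Hh t0) (mkposreal _ P0)) as [d Hd].
  assert (Hpos : forall s, t0 - d < s < t0 + d -> 0 < h s).
  { intros s Hs; assert (B : Rabs (h s - h t0) < h t0).
    { apply (Hd s); change (Rabs (s - t0) < d); apply Rabs_def1; lra. }
    apply Rabs_def2 in B; lra. }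
  set (p := Rmax lo (t0 - d / 2)). set (q := Rmin hi (t0 + d / 2)).
  assert (Hdp := cond_pos d).
  assert (Hp : lo <= p /\ t0 - d / 2 <= p /\ p <= t0).
  { unfold p, Rmax; destruct (Rle_dec _ _); lra. }
  assert (Hq : q <= hi /\ q <= t0 + d / 2 /\ t0 <= q).
  { unfold q, Rmin; destruct (Rle_dec _ _); lra. }
  assert (Hpq : p < q).
  { unfold p, q, Rmin, Rmax; destruct (Rle_dec _ _), (Rle_dec _ _); lra. }
  assert (Hge : forall a b, lo <= a <= b -> b <= hi ->
            0 <= RInt (fun s => k s * h s) a b).
  { intros a b Ha Hb; apply RInt_ge_0; [lra|now apply cont_ex_RInt|].
    intros s Hs; apply Hnn; lra. }
  assert (H1 := Hge lo p ltac:(lra) ltac:(lra)).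
  assert (H3 := Hge q hi ltac:(lra) ltac:(lra)).
  assert (H2 : 0 < RInt (fun s => k s * h s) p q).
  { apply RInt_gt_0; [easy| |intros; apply Hkh].
    intros s Hs; apply Rmult_lt_0_compat; [apply Pk; lra|apply Hpos; lra]. }
  rewrite <- (RInt_Chasles (fun s => k s * h s) lo p hi) by now apply cont_ex_RInt.
  rewrite <- (RInt_Chasles (fun s => k s * h s) p q hi) by now apply cont_ex_RInt.
  unfold plus; simpl; lra.
Qed.
(** The unknown is [y], since [bvp_sol] already encodes the boundary conditions. The hypothesis
    [eps * T <= Rr] keeps the two cutoffs in order throughout [[0,T]]. *)
Lemma bvp_truncated_solvable (T eta alpha beta eps Rr : R) (a f : R -> R) :
  0 < eta < T -> bvp_det T eta alpha beta <> 0 -> 0 <= eps -> eps * T <= Rr ->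
  continuous_on (cc 0 T) a -> continuous_on half_line f ->
  exists y, cont y /\ forall t, 0 <= t <= T ->
    y t = a t * f (clamp (eps * t) Rr (bvp_sol T eta alpha beta y t)).
Proof.
  intros He HD Heps HR Ha Hf.
  (* Clamping turns continuity relative to [[0,T]] and to the half-line into continuity on the whole
     line. All arguments given to [fbar] lie in [[0,Rr]], where Heine's theorem gives a uniform
     modulus. *)
  set (abar := fun t => a (clamp 0 T t)).
  set (fbar := fun x => f (clamp 0 Rr x)).
  set (lo := fun t => eps * clamp 0 T t).
  set (G := fun t x => abar t * fbar (clamp (lo t) Rr x)).
  assert (HRr : 0 <= Rr) by nra.
  assert (Hac : cont abar) by (apply (continuous_on_clamp (cc 0 T)); auto; lra).
  assert (Hfc : cont fbar).
  { apply (continuous_on_clamp half_line); auto; unfold half_line; intros; lra. }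
  assert (Hlo : forall t, 0 <= lo t <= Rr).
  { intros t; unfold lo; generalize (clamp_bounds 0 T t); nra. }
  assert (Hlc : cont lo).
  { intros t; apply (continuous_mult (fun _ => eps)); [apply continuous_const|apply cont_clamp]. }
  destruct (cont_bounded abar 0 T) as (Ba & HBa & Hab); [lra|easy|].
  destruct (cont_bounded fbar 0 Rr) as (Bf & HBf & Hfb); [lra|easy|].
  assert (Hab' : forall t, Rabs (abar t) <= Ba).
  { intros t; replace (abar t) with (abar (clamp 0 T t)).
    - apply Hab, clamp_bounds; lra.
    - unfold abar; now rewrite (clamp_id 0 T (clamp 0 T t)) by (apply clamp_bounds; lra). }
  assert (Hin : forall t x, 0 <= clamp (lo t) Rr x <= Rr).
  { intros t x; generalize (Hlo t) (clamp_bounds (lo t) Rr x); lra. }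
  assert (HGc : superposition G).
  { intros x Hx t; apply (continuous_mult abar); [apply Hac|].
    revert t; apply (cont_comp fbar (fun s => clamp (lo s) Rr (x s))); [easy|].
    now apply cont_clamp_comp. }
  assert (HGu : unif_cont_snd G).
  { intros e He'.
    assert (He2 : 0 < e / Ba) by (apply Rdiv_lt_0_compat; lra).
    destruct (Heine_cor2 (f := fbar) (a := 0) (b := Rr)
                (fun x _ => proj2 (continuity_pt_filterlim fbar x) (Hfc x))
                (mkposreal _ He2)) as [d Hd].
    exists d; split; [apply d|]; intros t x x' Hxx; unfold G.
    rewrite <- Rmult_minus_distr_l, Rabs_mult.
    assert (H : Rabs (fbar (clamp (lo t) Rr x) - fbar (clamp (lo t) Rr x')) < e / Ba).
    { apply Hd; auto; eapply Rle_lt_trans; [apply clamp_lipschitz|easy]. }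
    apply Rle_lt_trans with
      (Ba * Rabs (fbar (clamp (lo t) Rr x) - fbar (clamp (lo t) Rr x'))).
    - apply Rmult_le_compat_r; [apply Rabs_pos|apply Hab'].
    - apply Rmult_lt_compat_l with (r := Ba) in H; [|easy].
      replace (Ba * (e / Ba)) with e in H by (field; lra); exact H. }
  assert (HGb : forall t x, Rabs (G t x) <= Ba * Bf).
  { intros t x; unfold G; rewrite Rabs_mult.
    apply Rmult_le_compat; auto using Rabs_pos. }
  destruct (sup_lipschitz_prims T eta (2 * beta * eta / bvp_det T eta alpha beta)
    (- beta * (2 * T - alpha * eta ^ 2) / bvp_det T eta alpha beta)
    (- 2 * alpha * beta * eta / bvp_det T eta alpha beta)) as (LA & HLA & HlA); [lra|].
  destruct (sup_lipschitz_prims T eta (2 * (1 - beta) / bvp_det T eta alpha beta)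
    (2 * beta * (1 - alpha * eta) / bvp_det T eta alpha beta)
    (- 2 * alpha * (1 - beta) / bvp_det T eta alpha beta)) as (Lq & HLq & Hlq); [lra|].
  apply (sup_lipschitz_le _ _ (LA + Lq)) in HlA; [|lra|lra].
  apply (sup_lipschitz_le _ _ (LA + Lq)) in Hlq; [|lra|lra].
  destruct (functional_bvp_solvable T (Ba * Bf) (LA + Lq) G (bvp_A T eta alpha beta)
              (bvp_q T eta alpha beta)) as (u & Hu & Eu); auto; [lra|lra|].
  set (y := fun s => G s (u s)) in *.
  exists y; split; [apply (HGc u Hu)|]; intros t Ht.
  assert (E : u t = bvp_sol T eta alpha beta y t).
  { rewrite Eu; unfold path, bvp_sol; now rewrite (clamp_id 0 T t). }
  rewrite <- E; unfold y, G, abar, fbar, lo.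
  rewrite (clamp_id 0 T t) by easy.
  rewrite (clamp_id 0 Rr); [easy|].
  assert (eps * t <= Rr) by nra. assert (0 <= eps * t) by nra.
  generalize (clamp_bounds (eps * t) Rr (u t)); lra.
Qed.

(** * A priori bounds *)

Lemma bvp_det_pos (T eta alpha beta : R) :
  0 < eta < T -> 0 < alpha ->
  beta < (2 * T - alpha * eta ^ 2) / (alpha * eta ^ 2 - 2 * eta + 2 * T) ->
  0 < bvp_det T eta alpha beta.
Proof.
  intros He Ha Hb; unfold bvp_det.
  assert (0 < alpha * eta ^ 2) by (apply Rmult_lt_0_compat; nra).
  set (E := alpha * eta ^ 2 - 2 * eta + 2 * T) in *.
  assert (HE : 0 < E) by (unfold E; lra).
  apply Rmult_lt_compat_r with (r := E) in Hb; [|easy].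
  unfold Rdiv in Hb; rewrite Rmult_assoc, Rinv_l, Rmult_1_r in Hb; lra.
Qed.

(** The last bound comes from the second entry of the minimum, which is [alpha (beta + 1) eta / 2]
    times [eta / T]. Combined with [bvp_sol_right_lower] it gives [gamma u(eta) <= u(T)]. *)
Lemma gamma_bounds (T eta alpha beta : R) :
  0 < eta < T -> 0 < alpha -> 0 <= beta -> 0 < bvp_det T eta alpha beta ->
  0 < gamma T eta alpha beta /\ gamma T eta alpha beta <= 1 /\
  gamma T eta alpha beta <= alpha * (beta + 1) * eta / 2.
Proof.
  intros He Ha Hb HD.
  assert (Hae : 0 < alpha * eta) by nra.
  assert (Hk : 0 < alpha * (beta + 1)) by nra.
  (* [beta + 1 < (4T - 2eta) / (p - 2eta + 2T)] with [p = alpha eta^2], and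
     [p (4T - 2eta) < 2T (p - 2eta + 2T)] since [p < 2T]. *)
  assert (Hlt : alpha * (beta + 1) * eta ^ 2 < 2 * T).
  { unfold bvp_det in HD.
    assert (H0 : 0 < alpha * eta ^ 2) by (simpl; nra).
    set (p := alpha * eta ^ 2) in *.
    replace (alpha * (beta + 1) * eta ^ 2) with (p * (beta + 1)) by (unfold p; ring).
    apply Rmult_lt_reg_r with (p - 2 * eta + 2 * T); [lra|].
    assert (p * ((p - 2 * eta + 2 * T) * (beta + 1)) < p * (4 * T - 2 * eta))
      by (apply Rmult_lt_compat_l; lra).
    assert (p < 2 * T) by nra.
    assert (p * (2 * T - 2 * eta) < 2 * T * (2 * T - 2 * eta))
      by (apply Rmult_lt_compat_r; lra).
    lra. }
  unfold gamma.
  set (g1 := eta / T). set (g2 := alpha * (beta + 1) * eta ^ 2 / (2 * T)).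
  set (g3 := alpha * (beta + 1) * eta * (T - eta) / (2 * T - alpha * (beta + 1) * eta ^ 2)).
  assert (P1 : 0 < g1) by (apply Rdiv_lt_0_compat; lra).
  assert (P2 : 0 < g2) by (apply Rdiv_lt_0_compat; [simpl; apply Rmult_lt_0_compat; nra|lra]).
  assert (P3 : 0 < g3).
  { apply Rdiv_lt_0_compat; [|lra].
    repeat apply Rmult_lt_0_compat; lra. }
  assert (g1 <= 1).
  { unfold g1; apply Rmult_le_reg_r with T; [lra|].
    unfold Rdiv; rewrite Rmult_assoc, Rinv_l by lra; lra. }
  assert (g2 <= alpha * (beta + 1) * eta / 2).
  { replace g2 with (alpha * (beta + 1) * eta / 2 * g1) by (unfold g1, g2; field; lra).
    rewrite <- (Rmult_1_r (alpha * (beta + 1) * eta / 2)) at 2.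
    apply Rmult_le_compat_l; [|easy]; nra. }
  assert (H1 := Rmin_l g1 (Rmin g2 g3)).
  assert (H2 := Rmin_r g1 (Rmin g2 g3)).
  assert (H3 := Rmin_l g2 g3).
  split; [now repeat apply Rmin_pos|split; lra].
Qed.

Lemma superlinear_at_zero (f : R -> R) (l M : R) :
  filterlim (fun x => f x / x) (at_right 0) (locally l) -> M < l ->
  exists r, 0 < r /\ forall x, 0 < x <= r -> M * x <= f x.
Proof.
  intros Hf HM.
  assert (Hp : 0 < l - M) by lra.
  destruct (proj1 (filterlim_locally _ _) Hf (mkposreal _ Hp)) as [d Hd].
  assert (Hdp := cond_pos d).
  exists (d / 2); split; [lra|]; intros x Hx.
  assert (B : Rabs (f x / x - l) < l - M).
  { apply (Hd x); [|lra].
    change (Rabs (x - 0) < d); apply Rabs_def1; lra. }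
  apply Rabs_def2 in B.
  replace (f x) with (f x / x * x) by (field; lra).
  apply Rmult_le_compat_r; lra.
Qed.

Lemma sublinear_at_infty (f : R -> R) (l c r : R) :
  is_lim (fun x => f x / x) p_infty l -> continuous_on half_line f ->
  l < c -> 0 < c ->
  exists Rr, 0 < Rr /\ r <= Rr /\ forall x, 0 <= x <= Rr -> f x <= c * Rr.
Proof.
  intros Hf Hc Hlc Hc0.
  assert (Hp : 0 < c - l) by lra.
  destruct (proj2 (is_lim_spec _ _ _) Hf (mkposreal _ Hp)) as [X HX].
  assert (HX' : forall x, X < x -> 0 < x -> f x <= c * x).
  { intros x H1 H2; assert (B := HX x H1); simpl in B; apply Rabs_def2 in B.
    replace (f x) with (f x / x * x) by (field; lra).
    apply Rmult_le_compat_r; lra. }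
  set (X1 := Rmax X 1).
  assert (H1 : 1 <= X1) by apply Rmax_r. assert (H2 : X <= X1) by apply Rmax_l.
  destruct (cont_bounded (fun x => f (clamp 0 X1 x)) 0 X1) as (B & HB & Hb).
  { lra. }
  { apply (continuous_on_clamp half_line); auto; [lra|unfold half_line; intros; lra]. }
  (* Below [X1] the bound [B] is at most [c * Rr] by the choice of [B / c]; beyond [X1] one has
     [f x <= c * x <= c * Rr]. Positivity of [Rr] comes from [X1 >= 1]. *)
  exists (Rmax r (Rmax X1 (B / c))).
  assert (R1 := Rmax_l r (Rmax X1 (B / c))). assert (R2 := Rmax_r r (Rmax X1 (B / c))).
  assert (R3 := Rmax_l X1 (B / c)). assert (R4 := Rmax_r X1 (B / c)).
  set (Rr := Rmax r (Rmax X1 (B / c))) in *.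
  split; [lra|]; split; [easy|]; intros x Hx.
  destruct (Rle_dec x X1) as [Hx1|Hx1].
  - assert (H := Hb x ltac:(lra)); rewrite clamp_id in H by lra.
    assert (c * (B / c) <= c * Rr) by (apply Rmult_le_compat_l; lra).
    replace (c * (B / c)) with B in * by (field; lra).
    generalize (Rle_abs (f x)); lra.
  - apply Rle_trans with (c * x); [apply HX'; lra|apply Rmult_le_compat_l; lra].
Qed.
(** Serves both a priori bounds: for the upper one [y] is compared with [a], for the lower one the
    roles are exchanged and [k = / (M * m)]. *)
Lemma RInt_moment_le (y h : R -> R) (T lo k : R) :
  lo <= T -> cont y -> cont h -> (forall s, lo < s < T -> y s <= k * h s) ->
  RInt (fun s => (T - s) * y s) lo T <= k * RInt (fun s => (T - s) * h s) lo T.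
Proof.
  intros Hlo Hy Hh Hle.
  assert (E : RInt (fun s => scal k ((T - s) * h s)) lo T
              = k * RInt (fun s => (T - s) * h s) lo T).
  { apply (RInt_scal (fun s => (T - s) * h s)); apply cont_ex_RInt, cont_moment, Hh. }
  rewrite <- E; apply RInt_le; [easy|apply cont_ex_RInt, cont_moment, Hy| |].
  - apply (ex_RInt_scal (fun s => (T - s) * h s)), cont_ex_RInt, cont_moment, Hh.
  - intros s Hs; change (scal k ((T - s) * h s)) with (k * ((T - s) * h s)).
    generalize (Rmult_le_compat_l (T - s) _ _ ltac:(lra) (Hle s Hs)); lra.
Qed.

Lemma bvp_sol_positive_solution (T eta alpha beta : R) (a f y : R -> R) :
  0 < T -> bvp_det T eta alpha beta <> 0 -> cont y ->
  (forall t, 0 <= t <= T -> y t = a t * f (bvp_sol T eta alpha beta y t)) ->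
  (forall t, 0 <= t <= T -> 0 <= bvp_sol T eta alpha beta y t) ->
  (forall t, 0 < t < T -> 0 < bvp_sol T eta alpha beta y t) ->
  positive_solution T eta alpha beta a f (bvp_sol T eta alpha beta y).
Proof.
  intros HT HD Hy Ey H0 Hpos.
  assert (Hd2 : forall t, Derive_n (bvp_sol T eta alpha beta y) 2 t = - y t).
  { intros t; simpl.
    apply is_derive_unique; now apply is_derive2_bvp_sol. }
  split; [|split; [|split; [|split]]]; auto.
  - intros t _; eapply filterlim_filter_le_1; [apply filter_le_within|].
    now apply cont_bvp_sol.
  - intros t _; split; [|split].
    + eexists; now apply is_derive_bvp_sol.
    + eexists; now apply is_derive2_bvp_sol.
    + apply continuous_ext with (fun s => - y s).
      * intros s; now rewrite Hd2.
      * now apply (continuous_opp y).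
  - split; [|split].
    + intros t Ht; rewrite Hd2, <- Ey by lra; ring.
    + now apply bvp_sol_left.
    + now apply bvp_sol_right.
Qed.

(* If the solution stayed below [r0], then on [[eta,T]] the right-hand side would
   be at least [M a max(gamma u(eta), eps eta)], and [M > Lambda2] would give
   [gamma u(eta) > gamma u(eta)]; so it reaches [r0], and concavity propagates
   this to a lower bound linear in [t]. *)
Lemma bvp_sol_linear_lower (T eta alpha beta eps r0 Rr M : R) (a f y : R -> R) :
  0 < eta < T -> 0 < alpha -> 0 <= beta -> 0 < bvp_det T eta alpha beta ->
  0 < eps -> eps * T <= r0 -> r0 <= Rr ->
  cont a -> (forall t, 0 <= t <= T -> 0 <= a t) ->
  (forall x, 0 <= x -> 0 <= f x) ->
  0 < RInt (fun s => (T - s) * a s) eta T ->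
  Lambda2 T eta alpha beta a < M -> (forall x, 0 < x <= r0 -> M * x <= f x) ->
  cont y ->
  (forall t, 0 <= t <= T ->
     y t = a t * f (clamp (eps * t) Rr (bvp_sol T eta alpha beta y t))) ->
  forall t, 0 <= t <= T ->
    alpha * (beta + 1) * eta / 2 * (Rmin eta (T - eta) / T * r0) * t
    <= T * bvp_sol T eta alpha beta y t.
Proof.
  intros He Ha Hb HD Heps HepsT HrR Hac Han Hfn HJ HM Hf0 Hy Ey.
  destruct (gamma_bounds T eta alpha beta He Ha Hb HD) as (Hg0 & Hg1 & Hg2).
  unfold Lambda2 in HM; fold (bvp_det T eta alpha beta) in HM.
  set (D := bvp_det T eta alpha beta) in *.
  set (g := gamma T eta alpha beta) in *.
  set (J := RInt (fun s => (T - s) * a s) eta T) in *.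
  set (u := bvp_sol T eta alpha beta y) in *.
  set (w := fun t => clamp (eps * t) Rr (u t)).
  assert (Hw : forall t, 0 <= t <= T -> eps * t <= w t /\ 0 <= eps * t <= r0).
  { intros t Ht; assert (0 <= eps * t) by (apply Rmult_le_pos; lra).
    assert (eps * t <= eps * T) by (apply Rmult_le_compat_l; lra).
    split; [apply Rmax_l|lra]. }
  assert (Hyn : forall t, 0 <= t <= T -> 0 <= y t).
  { intros t Ht; rewrite Ey by easy; apply Rmult_le_pos; [now apply Han|].
    apply Hfn; generalize (Hw t Ht); unfold w; lra. }
  assert (Hun : forall t, 0 <= t <= T -> 0 <= u t)
    by (intros; now apply bvp_sol_nonneg).
  assert (HuT : alpha * (beta + 1) * eta / 2 * u eta <= u T)
    by (apply bvp_sol_right_lower; auto; apply Rgt_not_eq, HD).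
  assert (Hconc : forall p q r, 0 <= p <= q -> q <= r <= T ->
            (r - q) * u p + (q - p) * u r <= (r - p) * u q)
    by (intros; now apply bvp_sol_concave).
  assert (Hue := Hun eta ltac:(lra)).
  assert (Hlow : forall s, eta <= s <= T -> g * u eta <= u s).
  { intros s Hs; assert (Hc := Hconc eta s T ltac:(lra) ltac:(lra)).
    apply Rmult_le_reg_l with (T - eta); [lra|].
    assert (g * u eta <= u eta) by nra.
    assert (g * u eta <= u T).
    { eapply Rle_trans; [apply Rmult_le_compat_r; [easy|exact Hg2]|easy]. }
    assert ((T - s) * (g * u eta) <= (T - s) * u eta) by (apply Rmult_le_compat_l; lra).
    assert ((s - eta) * (g * u eta) <= (s - eta) * u T) by (apply Rmult_le_compat_l; lra).
    lra. }
  assert (Hreach : exists t1, 0 <= t1 <= T /\ r0 <= u t1).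
  { apply NNPP; intros Hno.
    assert (Hsmall : forall t, 0 <= t <= T -> u t < r0).
    { intros t Ht; apply Rnot_le_lt; intros H; apply Hno; now exists t. }
    (* The term [eps * eta] keeps [m] positive even if [u eta = 0], so that multiplying by [m]
       preserves the strict inequality from [Lambda2]. *)
    set (m := Rmax (g * u eta) (eps * eta)).
    assert (Hm : g * u eta <= m) by apply Rmax_l.
    assert (Hm' : eps * eta <= m) by apply Rmax_r.
    assert (Hm0 : 0 < m) by (assert (0 < eps * eta) by (apply Rmult_lt_0_compat; lra); lra).
    assert (HM0 : 0 < M).
    { eapply Rle_lt_trans; [|exact HM]; apply Rlt_le, Rdiv_lt_0_compat; [easy|].
      repeat apply Rmult_lt_0_compat; lra. }
    assert (HI : M * m * J <= RInt (fun s => (T - s) * y s) eta T).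
    { assert (Hk : 0 < M * m) by now apply Rmult_lt_0_compat.
      assert (H := RInt_moment_le a y T eta (/ (M * m)) ltac:(lra) Hac Hy).
      assert (HJ' : J <= / (M * m) * RInt (fun s => (T - s) * y s) eta T).
      { apply H; intros s Hs.
        apply Rmult_le_reg_l with (M * m); [easy|].
        rewrite <- Rmult_assoc, Rinv_r, Rmult_1_l by lra.
        rewrite Ey by lra; fold (w s).
        destruct (Hw s ltac:(lra)) as (W1 & W2).
        assert (Hes : eps * eta <= eps * s) by (apply Rmult_le_compat_l; lra).
        assert (W3 : w s <= r0).
        { apply Rmax_lub; [lra|]; eapply Rle_trans; [apply Rmin_l|].
          apply Rlt_le, Hsmall; lra. }
        assert (W4 : m <= w s).
        { apply Rmax_lub; [|lra].
          eapply Rle_trans; [|apply Rmax_r]; apply Rmin_glb; [apply Hlow; lra|].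
          generalize (Hlow s ltac:(lra)) (Hsmall s ltac:(lra)); lra. }
        rewrite (Rmult_comm (M * m)); apply Rmult_le_compat_l; [apply Han; lra|].
        eapply Rle_trans; [|apply Hf0; lra].
        apply Rmult_le_compat_l; lra. }
      apply Rmult_le_compat_l with (r := M * m) in HJ'; [|lra].
      rewrite <- Rmult_assoc, Rinv_r, Rmult_1_l in HJ' by lra; exact HJ'. }
    assert (HL := bvp_sol_eta_lower T eta alpha beta y He Ha HD Hy Hyn).
    fold D u in HL.
    assert (Hgej : 0 < 2 * g * eta * J) by (repeat apply Rmult_lt_0_compat; lra).
    assert (HMD : D < M * (2 * g * eta * J)).
    { apply Rmult_lt_compat_r with (r := 2 * g * eta * J) in HM; [|easy].
      unfold Rdiv in HM; rewrite Rmult_assoc, Rinv_l, Rmult_1_r in HM; lra. }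
    (* Contradiction in the form [D m < 2 g eta M J m <= g D u(eta) <= D m]. *)
    assert (2 * eta * (M * m * J) <= D * u eta).
    { eapply Rle_trans; [|exact HL]; apply Rmult_le_compat_l; lra. }
    assert (g * (2 * eta * (M * m * J)) <= g * (D * u eta))
      by (apply Rmult_le_compat_l; lra).
    assert (D * m < M * (2 * g * eta * J) * m) by (apply Rmult_lt_compat_r; lra).
    assert (D * (g * u eta) <= D * m) by (apply Rmult_le_compat_l; lra).
    lra. }
  destruct Hreach as (t1 & Ht1 & Hr1).
  (* [u eta] is compared with the chord from [t1] to the endpoint on the other side of [eta], where
     [u] is nonnegative. *)
  assert (Hmu : Rmin eta (T - eta) * r0 <= T * u eta).
  { assert (0 < r0) by (assert (0 < eps * T) by (apply Rmult_lt_0_compat; lra); lra).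
    destruct (Rle_dec t1 eta) as [H1|H1].
    - assert (Hc := Hconc t1 eta T ltac:(lra) ltac:(lra)).
      assert (0 <= (eta - t1) * u T) by (apply Rmult_le_pos; [lra|apply Hun; lra]).
      assert ((T - eta) * r0 <= (T - eta) * u t1) by (apply Rmult_le_compat_l; lra).
      assert (0 <= t1 * u eta) by (apply Rmult_le_pos; lra).
      apply Rle_trans with ((T - eta) * r0); [|lra].
      apply Rmult_le_compat_r; [lra|apply Rmin_r].
    - assert (Hc := Hconc 0 eta t1 ltac:(lra) ltac:(lra)).
      assert (0 <= (t1 - eta) * u 0) by (apply Rmult_le_pos; [lra|apply Hun; lra]).
      assert (eta * r0 <= eta * u t1) by (apply Rmult_le_compat_l; lra).
      assert (0 <= (T - t1) * u eta) by (apply Rmult_le_pos; lra).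
      apply Rle_trans with (eta * r0); [|lra].
      apply Rmult_le_compat_r; [lra|apply Rmin_l]. }
  assert (Hmu' : Rmin eta (T - eta) / T * r0 <= u eta).
  { apply Rmult_le_reg_l with T; [lra|].
    replace (T * (Rmin eta (T - eta) / T * r0)) with (Rmin eta (T - eta) * r0)
      by (field; lra); easy. }
  intros t Ht.
  assert (Hc := Hconc 0 t T ltac:(lra) ltac:(lra)).
  assert (0 <= (T - t) * u 0) by (apply Rmult_le_pos; [lra|apply Hun; lra]).
  assert (t * (alpha * (beta + 1) * eta / 2 * (Rmin eta (T - eta) / T * r0)) <= t * u T).
  { apply Rmult_le_compat_l; [lra|]; eapply Rle_trans; [|exact HuT].
    apply Rmult_le_compat_l; [lra|easy]. }
  lra.
Qed.

(** [bvp_sol_upper] applied to [y <= c Rr a] gives a bound that is linear in [Rr]; [c <= Lambda1]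
    says that the factor is at most 1. *)
Lemma bvp_sol_le_radius (T eta alpha beta c Rr : R) (a y : R -> R) :
  0 < eta < T -> 0 < alpha -> 0 <= beta -> 0 < bvp_det T eta alpha beta ->
  0 <= Rr -> cont a -> 0 < RInt (fun s => (T - s) * a s) 0 T ->
  c <= Lambda1 T eta alpha beta a ->
  cont y -> (forall t, 0 <= t <= T -> 0 <= y t) ->
  (forall t, 0 <= t <= T -> y t <= c * Rr * a t) ->
  forall t, 0 <= t <= T -> bvp_sol T eta alpha beta y t <= Rr.
Proof.
  intros He Ha Hb HD HR Hac HJ Hc Hy Hyn Hya t Ht.
  assert (HU := bvp_sol_upper T eta alpha beta y t He Ha Hb HD Hy Hyn Ht).
  assert (HV : prim (prim y) T <= c * Rr * RInt (fun s => (T - s) * a s) 0 T).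
  { assert (E := RInt_moment y T 0 Hy); rewrite !prim_0 in E.
    assert (E' : prim (prim y) T = RInt (fun s => (T - s) * y s) 0 T)
      by (rewrite E; ring).
    rewrite E'; apply RInt_moment_le; auto; [lra|]; intros; apply Hya; lra. }
  assert (EJ : RInt (fun s => T * (T - s) * a s) 0 T
               = T * RInt (fun s => (T - s) * a s) 0 T).
  { rewrite (RInt_ext _ (fun s => scal T ((T - s) * a s)))
      by (intros s _; apply Rmult_assoc).
    now apply (RInt_scal (fun s => (T - s) * a s)), cont_ex_RInt, cont_moment. }
  unfold Lambda1 in Hc; rewrite EJ in Hc; fold (bvp_det T eta alpha beta) in Hc.
  set (D := bvp_det T eta alpha beta) in *.
  set (J := RInt (fun s => (T - s) * a s) 0 T) in *.
  set (S := 2 * (beta + 1) + / T * beta * eta * (alpha * eta + 2) + alpha * beta * T) in *.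
  assert (HS : 0 < S).
  { assert (0 < / T) by (apply Rinv_0_lt_compat; lra).
    assert (0 <= / T * beta * eta * (alpha * eta + 2)).
    { repeat apply Rmult_le_pos; try lra; nra. }
    assert (0 <= alpha * beta * T) by (repeat apply Rmult_le_pos; lra).
    unfold S; lra. }
  assert (HSJ : 0 < S * (T * J)) by (repeat apply Rmult_lt_0_compat; lra).
  apply Rmult_le_compat_r with (r := S * (T * J)) in Hc; [|lra].
  unfold Rdiv in Hc; rewrite Rmult_assoc, Rinv_l, Rmult_1_r in Hc by lra.
  apply Rmult_le_reg_l with D; [easy|].
  assert (S * (T * prim (prim y) T) <= S * (T * (c * Rr * J))).
  { apply Rmult_le_compat_l; [lra|]; apply Rmult_le_compat_l; lra. }
  assert (c * (S * (T * J)) * Rr <= D * Rr) by (apply Rmult_le_compat_r; lra).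
  lra.
Qed.

(** * Choice of the constants and removal of the truncation *)

Lemma Lambda_ext (T eta alpha beta : R) (a b : R -> R) :
  0 <= eta <= T -> (forall t, 0 <= t <= T -> a t = b t) ->
  Lambda1 T eta alpha beta a = Lambda1 T eta alpha beta b /\
  Lambda2 T eta alpha beta a = Lambda2 T eta alpha beta b.
Proof.
  intros He Hab; unfold Lambda1, Lambda2; split; do 2 f_equal.
  - apply RInt_ext; rewrite Rmin_left, Rmax_right by lra.
    intros s Hs; rewrite Hab; [easy|lra].
  - apply RInt_ext; rewrite Rmin_left, Rmax_right by lra.
    intros s Hs; rewrite Hab; [easy|lra].
Qed.

Theorem corollary4p3
  (T eta alpha beta : R) (f a : R -> R)
  (theta1 theta2 alpha2 beta2 : R)
  (Heta : 0 < eta < T)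
  (Halpha : 0 < alpha < 2 * T / eta ^ 2)
  (Hbeta : 0 <= beta < (2 * T - alpha * eta ^ 2)
                         / (alpha * eta ^ 2 - 2 * eta + 2 * T))
  (Hf_cont : continuous_on half_line f)
  (Hf_nonneg : forall x, 0 <= x -> 0 <= f x)
  (Ha_cont : continuous_on (cc 0 T) a)
  (Ha_nonneg : forall t, 0 <= t <= T -> 0 <= a t)
  (Ha_pos : exists t0, eta <= t0 <= T /\ 0 < a t0)
  (Htheta2 : 1 <= theta2)
  (Hf_zero : filterlim (fun x => f x / x) (at_right 0) (locally alpha2))
  (Halpha2 : theta2 / gamma T eta alpha beta * Lambda2 T eta alpha beta a
               < alpha2)
  (Htheta1 : 0 < theta1 <= 1)
  (Hf_infty : is_lim (fun x => f x / x) p_infty (Finite beta2))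
  (Hbeta2 : 0 <= beta2 < theta1 * Lambda1 T eta alpha beta a) :
  exists u : R -> R, positive_solution T eta alpha beta a f u.
Proof.
  assert (Ha : 0 < alpha) by lra. assert (Hb : 0 <= beta) by lra.
  assert (HD : 0 < bvp_det T eta alpha beta) by (apply bvp_det_pos; lra).
  destruct (gamma_bounds T eta alpha beta Heta Ha Hb HD) as (Hg0 & Hg1 & _).
  set (abar := fun t => a (clamp 0 T t)).
  assert (Hab : forall t, 0 <= t <= T -> a t = abar t).
  { intros t Ht; unfold abar; now rewrite clamp_id. }
  assert (Habc : cont abar) by (apply (continuous_on_clamp (cc 0 T)); auto; lra).
  assert (Habn : forall t, 0 <= t <= T -> 0 <= abar t).
  { intros t Ht; rewrite <- Hab by easy; auto. }
  destruct (Lambda_ext T eta alpha beta a abar ltac:(lra) Hab) as [EL1 EL2].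
  rewrite EL1 in Hbeta2; rewrite EL2 in Halpha2.
  destruct Ha_pos as (t0 & Ht0 & Hat0); rewrite Hab in Hat0 by lra.
  assert (HJ : forall lo, 0 <= lo <= eta -> 0 < RInt (fun s => (T - s) * abar s) lo T).
  { intros lo Hlo; apply RInt_weight_pos with t0; auto using cont_rsub; try lra.
    - intros; lra.
    - intros s Hs; apply Habn; lra. }
  set (La1 := Lambda1 T eta alpha beta abar) in *.
  set (La2 := Lambda2 T eta alpha beta abar) in *.
  assert (HLa1 : beta2 < La1) by nra.
  assert (HLa2 : 0 < La2).
  { apply Rdiv_lt_0_compat; [exact HD|].
    apply Rmult_lt_0_compat; [|apply HJ; lra].
    repeat apply Rmult_lt_0_compat; lra. }
  assert (HLa2' : La2 < alpha2).
  { eapply Rle_lt_trans; [|exact Halpha2].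
    rewrite <- (Rmult_1_l La2) at 1; apply Rmult_le_compat_r; [lra|].
    apply Rmult_le_reg_r with (gamma T eta alpha beta); [easy|].
    unfold Rdiv; rewrite Rmult_assoc, Rinv_l, Rmult_1_r by lra; lra. }
  (* Midpoints leave room on both sides: [La2 < M < alpha2] and [beta2 < c < La1]. Moreover [c > 0],
     as [beta2 >= 0]. *)
  set (M := (La2 + alpha2) / 2). set (c := (La1 + beta2) / 2).
  destruct (superlinear_at_zero f alpha2 M Hf_zero) as (r0 & Hr0 & Hfr0);
    [unfold M; lra|].
  destruct (sublinear_at_infty f beta2 c r0 Hf_infty Hf_cont) as (Rr & HRr & HrR & HfR);
    [unfold c; lra|unfold c; lra|].
  set (k := alpha * (beta + 1) * eta / 2 * (Rmin eta (T - eta) / T)).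
  assert (Hk : 0 < k).
  { assert (0 < Rmin eta (T - eta)) by (apply Rmin_pos; lra).
    unfold k, Rdiv; repeat apply Rmult_lt_0_compat; try lra.
    apply Rinv_0_lt_compat; lra. }
  (* The entry 1 gives [eps * T <= r0]; the entry [k] puts [eps t] below [k r0 t / T], the lower
     bound supplied by [bvp_sol_linear_lower]. *)
  set (eps := Rmin 1 k * (r0 / T)).
  assert (Hmin0 : 0 < Rmin 1 k) by (apply Rmin_pos; lra).
  assert (Hmin1 := Rmin_l 1 k). assert (Hmink := Rmin_r 1 k).
  assert (HrT : 0 < r0 / T) by (apply Rdiv_lt_0_compat; lra).
  assert (Heps : 0 < eps) by (apply Rmult_lt_0_compat; lra).
  assert (HepsT : eps * T = Rmin 1 k * r0) by (unfold eps; field; lra).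
  assert (HepsT1 : eps * T <= r0) by nra.
  assert (HepsTk : eps * T <= k * r0) by nra.
  destruct (bvp_truncated_solvable T eta alpha beta eps Rr a f) as (y & Hy & Ey);
    auto; try lra.
  set (u := bvp_sol T eta alpha beta y) in *.
  assert (Hw : forall t, 0 <= t <= T -> 0 <= clamp (eps * t) Rr (u t) <= Rr).
  { intros t Ht; assert (eps * t <= eps * T) by (apply Rmult_le_compat_l; lra).
    assert (0 <= eps * t) by (apply Rmult_le_pos; lra).
    generalize (clamp_bounds (eps * t) Rr (u t)); lra. }
  assert (Hyn : forall t, 0 <= t <= T -> 0 <= y t).
  { intros t Ht; rewrite Ey by easy; apply Rmult_le_pos; auto.
    apply Hf_nonneg, Hw, Ht. }
  (* The argument of [f] lies in [[0,Rr]] by truncation, so [y <= c Rr a] holds before anything is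
     known about the size of [u]. *)
  assert (Hup : forall t, 0 <= t <= T -> u t <= Rr).
  { apply (bvp_sol_le_radius T eta alpha beta c Rr abar y); auto; try lra.
    - apply HJ; lra.
    - fold La1; unfold c; lra.
    - intros t Ht; rewrite Ey, Rmult_comm, <- Hab by easy.
      apply Rmult_le_compat_r; auto. }
  assert (Hlo : forall t, 0 <= t <= T -> eps * t <= u t).
  { intros t Ht.
    assert (H := bvp_sol_linear_lower T eta alpha beta eps r0 Rr M abar f y Heta Ha Hb HD
      Heps HepsT1 HrR Habc Habn Hf_nonneg (HJ eta ltac:(lra))
      ltac:(fold La2; unfold M; lra) Hfr0 Hy
      ltac:(intros s Hs; rewrite <- Hab by easy; now apply Ey) t Ht).
    fold u in H.
    apply Rmult_le_reg_l with T; [lra|]; eapply Rle_trans; [|exact H].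
    replace (T * (eps * t)) with (eps * T * t) by ring.
    apply Rmult_le_compat_r; [lra|].
    eapply Rle_trans; [exact HepsTk|]; right; unfold k; ring. }
  exists u; apply bvp_sol_positive_solution; auto; try lra.
  - intros t Ht; rewrite Ey by easy; f_equal; f_equal; fold u.
    now apply clamp_id; split; auto.
  - intros t Ht; generalize (Hlo t Ht).
    assert (0 <= eps * t) by (apply Rmult_le_pos; lra); fold u; lra.
  - intros t Ht; generalize (Hlo t ltac:(lra)).
    assert (0 < eps * t) by (apply Rmult_lt_0_compat; lra); fold u; lra.
Qed.
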